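(* Let $1\le p_0<p<\infty$, let $\Omega\subsetneq X$ be an open set, and assume that $w$ is a semilocally doubling $p_0$-Poincaré weight for $\Omega$. Assume that a pointwise $(p,w)$-Hardy inequality holds in $\Omega$. Then there exists a constant $C>0$ such that the $(p,w)$-Hardy inequality $$\int_\Omega\frac{|u(x)|^p}{d(x,\Omega^c)^p}\,w(x)\,d\mu(x)\le C\int_\Omega g(x)^p\,w(x)\,d\mu(x)$$ holds for every $u\in\operatorname{Lip}_0(\Omega)$ and for all bounded upper gradients $g$ of $u$.
   Context: Standing assumptions. $X=(X,d,\mu)$, with at least two points, is a metric measure space with a metric $d$ and a positive complete Borel regular measure $\mu$ such that, for some constant $D>1$, $0<\mu(B)<\infty$ and $\mu(2B)\le D\mu(B)$ for all balls $B=B(x,r)=\{y\in X: d(y,x)<r\}$, where $\lambda B=B(x,\lambda r)$. A curve is a rectifiable continuous map $\gamma:[a,b]\to X$, with length $\operatorname{len}(\gamma)$; it connects $x$ to $y$ (or to a set $E$) if $\gamma(a)=x$ and $\gamma(b)=y$ (respectively $\gamma(b)\in E$). $X$ is $C_{\mathrm{QC}}$-quasiconvex for a fixed $C_{\mathrm{QC}}\ge1$: all $x,y\in X$ are connected by a curve of length at most $C_{\mathrm{QC}}d(x,y)$. Open sets $\Omega$ are nonempty, $\Omega^c=X\setminus\Omega$, and $d(x,\Omega^c)=\inf_{y\in\Omega^c}d(x,y)$. Notation. For $\nu\ge 1$, $\Gamma(X)^\nu_{x,y}$ is the set of all curves connecting $x$ to $y$ with length at most $\nu d(x,y)$. $LC(X)$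 is the set of lower semicontinuous real-valued functions on $X$. A Borel function $g\ge0$ is an upper gradient of $u:X\to\mathbb R$ if $|u(\gamma(a))-u(\gamma(b))|\le\int_\gamma g\,ds$ for all curves $\gamma:[a,b]\to X$. $\operatorname{Lip}_0(\Omega)$ is the space of Lipschitz functions $u:X\to\mathbb R$ that vanish on $\Omega^c$. Weights. A weight for $\Omega$ is a non-negative Borel function $w$ on $X$ with $\int_B w\,d\mu<\infty$ for all balls $B\subset X$ and $w(x)>0$ for almost every $x\in\Omega$; $w(E)=\int_E w\,d\mu$. For $\Omega\subsetneq X$, $w$ is semilocally doubling for $\Omega$ if for every $\kappa>0$ there is a constant $D(w,\kappa)\ge1$ such that $0<w(B(x,r))\le D(w,\kappa)\,w(B(x,r/2))<\infty$ for all $x\in\Omega$ and $0<r\le\kappa d(x,\Omega^c)$. Maximal functions. For $1\le p<\infty$, $0<\kappa<\infty$, $f$ measurable and $x\in\Omega$, $\mathcal M_{p,w,\kappa}f(x)=\sup_{0<r<\kappa d(x,\Omega^c)}\big(\frac1{w(B(x,r))}\int_{B(x,r)}|f|^pw\,d\mu\big)^{1/p}$, and $\mathcal M^R_{p,w,\kappa}f(x)$ is the same supremum restricted to $0<r<\min\{\kappa d(x,\Omega^c),R\}$ (a supremum over the empty set is $0$). $p$-Poincaré weight. For $1\le p<\infty$, a weight $w$ for $\Omega\subsetneq X$ is a $p$-Poincaré weight for $\Omega$ if there are constants $C_{\mathrm A}>0$, $\nu>C_{\mathrm{QC}}$ and $\kappa>1$ such that for each non-negative bounded $g\in LC(X)$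 and all $x,y\in\Omega$ with $d(x,y)<d(x,\Omega^c)/(3\kappa)$, $$\inf_{\gamma\in\Gamma(X)^\nu_{x,y}}\int_\gamma g\,ds\le C_{\mathrm A}\,d(x,y)\big(\mathcal M^{\kappa d(x,y)}_{p,w,\kappa}g(x)+\mathcal M^{\kappa d(x,y)}_{p,w,\kappa}g(y)\big).$$ Pointwise Hardy inequality. For $1\le p<\infty$, a pointwise $(p,w)$-Hardy inequality holds in $\Omega$ if there are constants $C_{\mathrm H}>0$ and $\kappa>1$ such that for every $u\in\operatorname{Lip}_0(\Omega)$, every bounded upper gradient $g$ of $u$ and every $x\in\Omega$, $|u(x)|\le C_{\mathrm H}\,d(x,\Omega^c)\,\mathcal M_{p,w,\kappa}g(x)$. *)

(* Defs.v *)
From HB Require Import structures.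
From mathcomp Require Import all_boot all_order all_algebra.
From mathcomp Require Import all_classical all_reals all_analysis.
From mathcomp Require Import measurable_realfun.
Import Order.TTheory GRing.Theory Num.Theory.
Import numFieldNormedType.Exports.

Set Implicit Arguments.
Unset Strict Implicit.
Unset Printing Implicit Defensive.

Local Open Scope classical_set_scope.
Local Open Scope ring_scope.

(* No relation between the metric and the sigma-algebra is built in here;
   it is imposed by [borel_regular] below. *)
#[short(type="metricMeasurableType")]
HB.structure Definition MetricMeasurable (d : measure_display)
  (R : numDomainType) := { X of Measurable d X & Metric R X }.

Section metric.
Context {R : realType} {X : metricType R}.

Definition dist_set (x : X) (A : set X) : R := inf [set mdist x y | y in A].

Definition lipschitz_fun (u : X -> R) :=
  exists2 L : R, 0 <= L & forall x y, `|u x - u y| <= L * mdist x y.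

Definition Lip0 (Omega : set X) : set (X -> R) :=
  [set u | lipschitz_fun u /\ forall x, ~ Omega x -> u x = 0].

(* Same shape as [variation] for real-valued functions: [s] lists the points
   of a partition of [a, b] after [a]. *)
Definition polygonal_length (a b : R) (gamma : R -> X) (s : seq R) : R :=
  let F := gamma \o nth b (a :: s) in
  \sum_(0 <= n < size s) mdist (F n) (F n.+1).

Definition length_on (a b : R) (gamma : R -> X) : \bar R :=
  ereal_sup [set (polygonal_length a b gamma s)%:E | s in itv_partition a b].

End metric.

(* The values of [curve_map] outside [curve_lo, curve_hi] are irrelevant. *)
Record curve (R : realType) (X : metricType R) := Curve {
  curve_lo : R ;
  curve_hi : R ;
  curve_map :> R -> X ;
  curve_le : curve_lo <= curve_hi ;
  curve_continuous : {within `[curve_lo, curve_hi], continuous curve_map} ;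
  curve_rectifiable : (length_on curve_lo curve_hi curve_map < +oo)%E
}.

Section curves.
Context {R : realType} {X : metricType R}.
Implicit Types (gamma : curve X) (x y : X).

Definition len gamma : R :=
  fine (length_on (curve_lo gamma) (curve_hi gamma) gamma).

Definition connects gamma x y :=
  gamma (curve_lo gamma) = x /\ gamma (curve_hi gamma) = y.

Definition quasiconvex (C : R) :=
  forall x y, exists2 gamma, connects gamma x y & len gamma <= C * mdist x y.

(* The set of curves written Gamma(X)^nu_{x,y}. *)
Definition Gamma (nu : R) x y : set (curve X) :=
  [set gamma | connects gamma x y /\ len gamma <= nu * mdist x y].

(* Arc length parametrization on [0, len gamma]: the last time at which the
   length run through by [gamma] equals [s], mapped to X. *)
Definition arclength_param gamma (s : R) : X :=
  gamma (sup [set t | curve_lo gamma <= t <= curve_hi gamma /\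
                      length_on (curve_lo gamma) t gamma = s%:E]).

Definition path_integral (g : X -> R) gamma : \bar R :=
  \int[lebesgue_measure]_(s in `[0, len gamma])
    (g (arclength_param gamma s))%:E.

End curves.

Section metric_measure.
Context {R : realType} {d : measure_display} {X : metricMeasurableType d R}.
Implicit Types (mu : {measure set X -> \bar R}) (Omega : set X).

Definition Borel_set : set (set X) := <<s @open X >>.

Definition Borel_fun {d' : measure_display} {T : measurableType d'}
    (f : X -> T) :=
  measurable_fun [set: g_sigma_algebraType (@open X)] f.

Definition borel_regular mu :=
  (forall U : set X, open U -> measurable U) /\
  (forall A : set X, measurable A ->
     exists B, [/\ Borel_set B, A `<=` B & mu B = mu A]).

Definition doubling mu :=
  exists2 D : R, 1 < D & forall (x : X) (r : R), 0 < r ->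
    [/\ (0 < mu (ball x r))%E, (mu (ball x r) < +oo)%E
      & (mu (ball x (2 * r)%R) <= D%:E * mu (ball x r))%E].

Definition bounded_function (g : X -> R) :=
  exists M : R, forall x, `|g x| <= M.

(* Real-valued candidates suffice, since only bounded upper gradients occur. *)
Definition upper_gradient (u g : X -> R) :=
  [/\ Borel_fun g, (forall x, 0 <= g x) &
      forall gamma : curve X,
        (`|u (gamma (curve_lo gamma)) - u (gamma (curve_hi gamma))|%:E
           <= path_integral g gamma)%E].

Definition wmeas mu (w : X -> \bar R) (E : set X) : \bar R :=
  \int[mu]_(x in E) w x.

Definition is_weight mu (w : X -> \bar R) Omega :=
  [/\ Borel_fun w, (forall x, (0 <= w x)%E),
      (forall (x : X) (r : R), 0 < r -> (wmeas mu w (ball x r) < +oo)%E) &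
      {ae mu, forall x, Omega x -> (0 < w x)%E}].

Definition semilocally_doubling mu (w : X -> \bar R) Omega :=
  forall kappa : R, 0 < kappa ->
    exists2 D : R, 1 <= D & forall (x : X) (r : R), Omega x ->
      0 < r -> r <= kappa * dist_set x (~` Omega) ->
      [/\ (0 < wmeas mu w (ball x r))%E,
          (wmeas mu w (ball x r) <= D%:E * wmeas mu w (ball x (r / 2)%R))%E
        & (D%:E * wmeas mu w (ball x (r / 2)%R) < +oo)%E].

Definition weighted_mean mu (w : X -> \bar R) (p : R) (f : X -> R)
    (x : X) (r : R) : \bar R :=
  (((wmeas mu w (ball x r))^-1 *
    \int[mu]_(y in ball x r) ((`|f y| `^ p)%:E * w y)) `^ p^-1)%E.

(* [0] is added so that the supremum over an empty set of radii is 0. *)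
Definition maximal_below mu (w : X -> \bar R) (p rho : R) (f : X -> R)
    (x : X) : \bar R :=
  ereal_sup ([set 0%E] `|`
    [set weighted_mean mu w p f x r | r in [set r | 0 < r < rho]]).

Definition maximal mu (w : X -> \bar R) Omega (p kappa : R) (f : X -> R)
    (x : X) : \bar R :=
  maximal_below mu w p (kappa * dist_set x (~` Omega)) f x.

Definition restricted_maximal mu (w : X -> \bar R) Omega (p kappa rho : R)
    (f : X -> R) (x : X) : \bar R :=
  maximal_below mu w p (Num.min (kappa * dist_set x (~` Omega)) rho) f x.

Definition poincare_weight mu (CQC : R) (w : X -> \bar R) Omega (p : R) :=
  is_weight mu w Omega /\
  exists CA nu kappa : R, [/\ 0 < CA, CQC < nu, 1 < kappa &
    forall g : X -> R,
      lower_semicontinuous (EFin \o g) -> (forall x, 0 <= g x) ->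
      bounded_function g ->
    forall x y : X, Omega x -> Omega y ->
      mdist x y < dist_set x (~` Omega) / (3 * kappa) ->
      (ereal_inf [set path_integral g gamma | gamma in Gamma nu x y]
       <= CA%:E * (mdist x y)%:E *
          (restricted_maximal mu w Omega p kappa (kappa * mdist x y)%R g x +
           restricted_maximal mu w Omega p kappa (kappa * mdist x y)%R g y))%E].

Definition pointwise_hardy mu (w : X -> \bar R) Omega (p : R) :=
  exists CH kappa : R, [/\ 0 < CH, 1 < kappa &
    forall u g : X -> R, Lip0 Omega u -> upper_gradient u g ->
      bounded_function g ->
    forall x : X, Omega x ->
      (`|u x|%:E <= CH%:E * (dist_set x (~` Omega))%:E *
                    maximal mu w Omega p kappa g x)%E].

End metric_measure.

Arguments quasiconvex {R} X C.

(* Main.v *)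
Require Import Defs.
From mathcomp Require Import all_boot all_order all_algebra.
From mathcomp Require Import all_classical all_reals all_analysis.
From mathcomp Require Import measurable_realfun.
From mathcomp Require Import ring lra.
Import Order.TTheory GRing.Theory Num.Theory.
Import numFieldNormedType.Exports.
Local Open Scope classical_set_scope.
Local Open Scope ring_scope.
Set Implicit Arguments.
Unset Strict Implicit.
Unset Printing Implicit Defensive.

(** Write [D x] for the distance from [x] to the complement of Omega.  The
    pointwise inequality by itself only yields weak-type information, since the
    p-maximal operator is not bounded on L^p(w).  Two devices lead from it to
    the integral inequality.

    Truncation, on one distance shell.  Let [v] vanish outside Omega and apply
    the pointwise inequality to the truncation of |v| between the levels [s] and
    [2 s].  Up to a Lipschitz cut-off its upper gradient is the upper gradient of
    [v] restricted to the region where |v| is comparable to [s].  At each point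
    with |v| >= 2 s the truncation equals [s], so the maximal function provides
    a ball on which the mean of that gradient is large; a Vitali covering by
    such balls and the semilocal doubling of [w] bound s^p w{|v| >= 2 s} on the
    shell t/2 < D <= t ([level_estimate]).  The regions belonging to dyadic
    levels overlap at most three times, and summation gives ([shell_estimate])

      int_{t/2 < D <= t} |v|^p w <= C t^p int_{D <= c t, v <> 0} g_v^p w.

    Logarithmic cut-off.  Dividing by t^p and summing over dyadic [t] would
    count a point in all scales larger than its distance, a logarithmic
    divergence.  Instead the shell estimate is applied to u phi(D), where phi
    is 1 for D >= t, vanishes for D <= t 2^-N, and is linear in ln D in between.
    Its slope is at most 1 / (N ln 2 D), which gives ([hardy_shell])

      a(t) <= K int_{t 2^-N < D <= 2^m t} (g^p + (N ln 2)^-p |u|^p / D^p) w,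

    where a(t) is the integral of |u|^p / D^p w over t/2 < D <= t.  Now a shell
    is counted in at most m + N scales.  Hence after summation the Hardy
    integral reappears on the right with a factor of order N^(1 - p), which is
    small for large N because p > p0 >= 1, and it can be absorbed
    ([absorb_window]).  The absorption is done on finitely many scales: each
    a(t) is at most a constant times the right-hand side by the shell estimate
    for [u] itself, which makes all terms finite and also controls the boundary
    scales.

    The upper gradients of the truncations and of the cut-offs come from a
    first-order calculus with quadratic errors ([upper_gradient_rule]):
    along the arc length parametrization of a curve such errors disappear when
    the curve is divided into many short pieces. *)

(** * Length of curves *)

Section chain_length.
Context {R : realType} {X : metricType R}.
Implicit Types (c : R -> X) (s t : seq R).

(** The length of the polygon through [c a] and the images of [s], by recursion
    on [s]; this form suits inductive proofs better than the indexed sum. *)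
Fixpoint chain_length c (a : R) s : R :=
  if s is x :: s' then mdist (c a) (c x) + chain_length c x s' else 0.

Lemma polygonal_lengthE a b c s : polygonal_length a b c s = chain_length c a s.
Proof.
elim: s a => [a|x s IH a]; rewrite /polygonal_length /=; first by rewrite big_nil.
rewrite big_nat_recl//= -(IH x); congr (_ + _).
Qed.

Lemma chain_length_cat c a s t :
  chain_length c a (s ++ t) = chain_length c a s + chain_length c (last a s) t.
Proof. by elim: s a => [a|x s IH a] /=; rewrite ?add0r// IH addrA. Qed.

Lemma length_ub a b c s : itv_partition a b s ->
  ((chain_length c a s)%:E <= length_on a b c)%E.
Proof.
move=> abs; apply: ereal_sup_ubound; exists s => //.
by rewrite polygonal_lengthE.
Qed.

Lemma length_le a b c (M : \bar R) :
  (forall s, itv_partition a b s -> ((chain_length c a s)%:E <= M)%E) ->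
  (length_on a b c <= M)%E.
Proof.
move=> H; apply: ge_ereal_sup => _ [s abs <-].
by rewrite polygonal_lengthE; exact: H.
Qed.

Lemma length_on_ge_mdist a b c : a <= b ->
  ((mdist (c a) (c b))%:E <= length_on a b c)%E.
Proof.
rewrite le_eqVlt => /predU1P[<-|ab].
  by rewrite mdistxx; apply: (@length_ub a a c [::]).
have := @length_ub a b c [:: b] (itv_partition1 ab).
by rewrite /= addr0.
Qed.

Lemma length_on_ge0 a b c : a <= b -> (0 <= length_on a b c)%E.
Proof.
by move=> /(length_on_ge_mdist c); apply: le_trans; rewrite lee_fin mdist_ge0.
Qed.

Lemma length_onxx a c : length_on a a c = 0%E.
Proof.
apply/eqP; rewrite eq_le length_on_ge0// andbT.
by apply: length_le => s /itv_partitionxx ->.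
Qed.

(** Inserting the point [m] into a partition does not decrease the length of
    the polygon, by the triangle inequality. *)
Lemma split_partition c a m b s : a <= m -> m <= b -> itv_partition a b s ->
  exists s1 s2, [/\ itv_partition a m s1, itv_partition m b s2 &
    chain_length c a s <= chain_length c a s1 + chain_length c m s2].
Proof.
elim: s a => [a am mb /itv_partition_nil ab|x s IH a am mb abs].
  have -> : m = a by apply/eqP; rewrite eq_le am andbT ab.
  by exists [::], [::]; split; rewrite /= ?addr0//; split => //; apply/eqP.
case: (abs) => /= /andP[ax xs] xb.
have [mx|xm] := ltP m x.
  move: am; rewrite le_eqVlt => /predU1P[am|am].
    exists [::], (x :: s); split; rewrite ?add0r//=; first by split => //=; apply/eqP.
      by split => //=; rewrite -am ax.
    by rewrite am.
  exists [:: m], (x :: s); split => //=; first exact: itv_partition1.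
    by split => //=; rewrite mx.
  by rewrite addr0 addrA lerD2r; exact: metric_triangle.
have [s1 [s2 [h1 h2 h3]]] := IH x xm mb (itv_partition_cons abs).
exists (x :: s1), s2; split => //=.
  by case: h1 => h1 h1'; split => //=; rewrite ax.
by rewrite -addrA lerD2l.
Qed.

(** One inequality is [split_partition]; for the other, partitions of the two
    parts are concatenated.  The latter takes suprema one after the other, which
    needs finite lengths. *)
Lemma length_onD a m b c : a <= m -> m <= b ->
  (length_on a b c = length_on a m c + length_on m b c)%E.
Proof.
move=> am mb; apply/eqP; rewrite eq_le; apply/andP; split.
  apply: length_le => s abs.
  have [s1 [s2 [h1 h2 h3]]] := split_partition c am mb abs.
  rewrite (le_trans (y := (chain_length c a s1 + chain_length c m s2)%:E))//.
  by rewrite EFinD leeD// length_ub.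
have [->|abfin] := eqVneq (length_on a b c) +oo%E; first by rewrite leey.
have fab : length_on a b c \is a fin_num.
  by rewrite ge0_fin_numE ?length_on_ge0 ?(le_trans am)// lt_neqAle abfin leey.
have key s1 s2 : itv_partition a m s1 -> itv_partition m b s2 ->
    ((chain_length c a s1)%:E + (chain_length c m s2)%:E <= length_on a b c)%E.
  move=> h1 h2; rewrite -EFinD.
  have -> : chain_length c a s1 + chain_length c m s2 =
            chain_length c a (s1 ++ s2).
    by rewrite chain_length_cat; case: h1 => _ /eqP ->.
  by apply: length_ub; exact: itv_partition_cat h1 h2.
have : (length_on a m c <= length_on a b c - length_on m b c)%E.
  apply: length_le => s1 h1.
  have : (length_on m b c <= length_on a b c - (chain_length c a s1)%:E)%E.
    by apply: length_le => s2 h2; rewrite leeBrDr// addeC key.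
  move=> h.
  have fmb : length_on m b c \is a fin_num.
    rewrite ge0_fin_numE ?length_on_ge0//; apply: (le_lt_trans h).
    by rewrite -(fineK fab) -EFinD ltry.
  rewrite leeBrDr// addeC -leeBrDr//.
move=> h.
have fmb : length_on m b c \is a fin_num.
  rewrite ge0_fin_numE ?length_on_ge0//.
  rewrite ltey; apply/negP => /eqP e; move: h; rewrite e.
  rewrite addeNy; move/(le_trans (length_on_ge0 c am)).
  by rewrite leeNy_eq.
by rewrite -leeBrDr.
Qed.

End chain_length.

Section rectifiable.
Context {R : realType} {X : metricType R}.
Variables (a b : R) (c : R -> X).
Hypothesis ab : a <= b.
Hypothesis cc : {within `[a, b], continuous c}.
Hypothesis rect : (length_on a b c < +oo)%E.

Lemma within_continuous_mdist x e : a <= x <= b -> 0 < e ->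
  exists2 dl, 0 < dl &
    forall t, a <= t <= b -> `|x - t| < dl -> mdist (c x) (c t) < e.
Proof.
move=> xab e0.
have := (@subspace_continuousP _ `[a, b]%classic _ c).1 cc x.
move=> /(_ _)/metricType_numDomainType.cvgr_dist_lt; move=> /(_ _ e e0).
rewrite /= in_itv/= => /(_ xab).
rewrite near_withinE => /nbhs_ballP[dl /= dl0 H].
by exists dl => // t tab xt; apply: H => //=; rewrite in_itv.
Qed.

Definition running_length t : R := fine (length_on a t c).
Local Notation L := running_length.

Lemma sublength_fin x y : a <= x -> x <= y -> y <= b ->
  length_on x y c \is a fin_num.
Proof.
move=> ax xy yb; rewrite ge0_fin_numE ?length_on_ge0//.
apply: le_lt_trans rect.
rewrite (@length_onD _ _ a x b)//; last exact: le_trans yb.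
rewrite (@length_onD _ _ x y b)//.
by rewrite (le_trans (leeDl _ (length_on_ge0 c yb)))// leeDr// length_on_ge0.
Qed.

Lemma running_lengthE t : a <= t -> t <= b -> (L t)%:E = length_on a t c.
Proof. by move=> at_ tb; rewrite fineK// sublength_fin. Qed.

Lemma running_lengthB x y : a <= x -> x <= y -> y <= b ->
  length_on x y c = (L y - L x)%:E.
Proof.
move=> ax xy yb; rewrite EFinB !running_lengthE//; try by [exact: le_trans yb|exact: le_trans xy].
rewrite (@length_onD _ _ a x y)// addeAC subee ?add0e//.
by rewrite sublength_fin//; exact: le_trans yb.
Qed.

Lemma running_length_mdist x y : a <= x -> x <= y -> y <= b ->
  mdist (c x) (c y) <= L y - L x.
Proof. by move=> ax xy yb; rewrite -lee_fin -running_lengthB// length_on_ge_mdist. Qed.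

Lemma running_length_le x y : a <= x -> x <= y -> y <= b -> L x <= L y.
Proof.
move=> ax xy yb; rewrite -subr_ge0.
by apply: le_trans (running_length_mdist ax xy yb); exact: mdist_ge0.
Qed.

(** A polygon on [x, b] that is almost as long as the curve can have its first
    step subdivided at [t], and the new first step is short by continuity of
    [c]; so little length lies between [x] and [t]. *)
Lemma running_length_right x e : a <= x -> x < b -> 0 < e ->
  exists2 dl, 0 < dl & forall t, x <= t -> t <= b -> t < x + dl -> L t < L x + e.
Proof.
move=> ax xb e0; have e20 : 0 < e / 2 by rewrite divr_gt0.
have fxb : length_on x b c \is a fin_num by rewrite sublength_fin// ltW.
have [_ [s xbs <-]] := ub_ereal_sup_adherent e20 fxb.
rewrite -/(length_on x b c) polygonal_lengthE.
case: s xbs => [/itv_partition_nil xb'|i s [/= /andP[xi js] sb]].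
  by move: xb; rewrite xb' ltxx.
rewrite running_lengthB//; last exact: ltW.
rewrite -EFinB lte_fin => H.
have [dl dl0 Hdl] := within_continuous_mdist (e := e / 2) (x := x) ltac:(rewrite ax ltW//) e20.
exists (Num.min dl (i - x)); first by rewrite lt_min dl0 subr_gt0.
move=> t xt tb; rewrite -ltrBlDl lt_min => /andP[td ti].
have := Hdl t; rewrite (le_trans ax xt) tb distrC ger0_norm ?subr_ge0// td => /(_ isT isT) h1.
have {}ti : t < i by lra.
have : chain_length c t (i :: s) <= L b - L t.
  rewrite -lee_fin -running_lengthB//; last exact: le_trans xt.
  by apply: length_ub; split => //=; rewrite ti.
have := metric_triangle (c x) (c t) (c i).
move: H => /=; lra.
Qed.

(** Mirror image of [running_length_right], with the last step of a polygon on
    [a, x]. *)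
Lemma running_length_left x e : a < x -> x <= b -> 0 < e ->
  exists2 dl, 0 < dl & forall t, a <= t -> t <= x -> x - dl < t -> L x - e < L t.
Proof.
move=> ax xb e0; have e20 : 0 < e / 2 by rewrite divr_gt0.
have fxb : length_on a x c \is a fin_num by rewrite sublength_fin// ltW.
have [_ [s xbs <-]] := ub_ereal_sup_adherent e20 fxb.
rewrite -/(length_on a x c) polygonal_lengthE.
case/lastP: s xbs => [/itv_partition_nil xb'|s i [/= ]].
  by move: ax; rewrite xb' ltxx.
rewrite rcons_path last_rcons => /andP[js si] /eqP ei; subst i.
rewrite -cats1 chain_length_cat /= addr0.
rewrite -running_lengthE//; last exact: ltW.
rewrite -EFinB lte_fin => H.
set i := last a s in H si.
have [dl dl0 Hdl] := within_continuous_mdist (e := e / 2) (x := x) ltac:(rewrite (ltW ax)//) e20.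
exists (Num.min dl (x - i)); first by rewrite lt_min dl0 subr_gt0.
move=> t at_ tx; rewrite ltrBlDr -ltrBlDl lt_min => /andP[td ti].
have tb := le_trans tx xb.
have := Hdl t; rewrite at_ tb ger0_norm ?subr_ge0// td => /(_ isT isT) h1.
have {}ti : i < t by lra.
have : chain_length c a (rcons s t) <= L t.
  rewrite -lee_fin running_lengthE//.
  by apply: length_ub; split; rewrite ?rcons_path ?last_rcons// js.
rewrite -cats1 chain_length_cat /= addr0 -/i.
have := metric_triangle (c i) (c t) (c x).
rewrite (metric_sym (c t) (c x)).
move: H => /=; lra.
Qed.

Lemma running_length_continuous : {within `[a, b], continuous L}.
Proof.
apply/subspace_continuousP => x /=; rewrite in_itv/= => /andP[ax xb].
apply/cvgrPdist_lt => e e0; rewrite near_withinE; apply/nbhs_ballP.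
have [dl1 d10 H1] : exists2 dl, 0 < dl &
    forall t, x <= t -> t <= b -> t < x + dl -> L t < L x + e.
  move: xb; rewrite le_eqVlt => /predU1P[xb|xb].
    exists 1 => // t xt tb _; suff -> : t = x by rewrite ltrDl.
    by apply/eqP; rewrite eq_le xt xb tb.
  exact: running_length_right.
have [dl2 d20 H2] : exists2 dl, 0 < dl &
    forall t, a <= t -> t <= x -> x - dl < t -> L x - e < L t.
  move: ax; rewrite le_eqVlt => /predU1P[ax|ax].
    exists 1 => // t at_ tx _; suff -> : t = x by rewrite ltrBlDr ltrDl.
    by apply/eqP; rewrite eq_le tx -ax at_.
  exact: running_length_left.
exists (Num.min dl1 dl2); first by rewrite /= lt_min d10.
move=> t /=; rewrite /ball/= lt_min => /andP[h1 h2]; rewrite in_itv/= => /andP[at_ tb].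
change (`|L x - L t| < e).
have [xt|tx] := leP x t.
  have := running_length_le ax xt tb.
  rewrite distrC ger0_norm ?subr_ge0// in h1.
  have := H1 t xt tb ltac:(lra) => ? ?.
  rewrite ltr_distlC; lra.
have tx' := ltW tx.
have := running_length_le at_ tx' xb.
rewrite ger0_norm ?subr_ge0// in h2.
have := H2 t at_ tx' ltac:(lra) => ? ?.
rewrite ltr_distlC; lra.
Qed.

(** The parameter that [arclength_param] evaluates the curve at. *)
Definition last_time s := sup [set t | a <= t <= b /\ length_on a t c = s%:E].

Lemma running_length_a : L a = 0.
Proof. by rewrite /L length_onxx. Qed.

(** Continuity of the running length makes the value [s] attained (intermediate
    values) and attained last (left continuity), so the supremum defining
    [last_time] behaves as a maximum. *)
Lemma last_timeP s : 0 <= s -> s <= L b ->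
  [/\ a <= last_time s, last_time s <= b, L (last_time s) = s &
      forall t, a <= t -> t <= b -> L t <= s -> t <= last_time s].
Proof.
move=> s0 sL; pose S := [set t | a <= t <= b /\ length_on a t c = s%:E].
have [t0 t0ab Lt0] : exists2 t, t \in `[a, b] & L t = s.
  apply: IVT => //; first exact: running_length_continuous.
  have L0b : 0 <= L b by exact: le_trans sL.
  by rewrite running_length_a (min_idPl L0b) (max_idPr L0b) s0.
move: t0ab; rewrite in_itv/= => /andP[at0 t0b].
have St0 : S t0 by rewrite /S/= at0 t0b -running_lengthE// Lt0.
have ubS : ubound S b by move=> t [/andP[]].
have hS : has_sup S by split; [exists t0|exists b].
have t0s : t0 <= last_time s by apply: ub_le_sup => //; exists b.
have sb : last_time s <= b by apply: ge_sup => //; exists t0.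
have as_ : a <= last_time s by exact: le_trans t0s.
have Ls : L (last_time s) = s.
  apply/eqP; rewrite eq_le; apply/andP; split; last first.
    by rewrite -[leLHS]Lt0 running_length_le.
  rewrite leNgt; apply/negP => sL'.
  have [e|/eqP ne] := eqVneq a (last_time s).
    by move: sL'; rewrite -e running_length_a ltNge s0.
  have alt : a < last_time s by rewrite lt_neqAle as_ andbT; apply/eqP.
  have e0 : 0 < L (last_time s) - s by rewrite subr_gt0.
  have [dl dl0 H] := running_length_left alt sb e0.
  have [t [/andP[at_ tb] Lt] ht] := sup_adherent dl0 hS.
  have ts : t <= last_time s by apply: ub_le_sup; [exists b|split => //; rewrite at_].
  have := H t at_ ts ht.
  by rewrite -lte_fin (running_lengthE at_ tb) Lt lte_fin opprB addrCA subrr addr0 ltxx.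
split => // t at_ tb Lts.
rewrite leNgt; apply/negP => st.
have : L (last_time s) <= L t by apply: running_length_le => //; exact: ltW.
rewrite Ls => h; have {}Lts : L t = s by apply/eqP; rewrite eq_le Lts h.
move: st; rewrite ltNge => /negP; apply; apply: ub_le_sup; first by exists b.
by split; rewrite ?at_// -running_lengthE// Lts.
Qed.

End rectifiable.

(** * Integrals over intervals *)

Section real_integrals.
Context {R : realType}.
Notation leb := (@lebesgue_measure R).

Lemma lebesgue_measure_translate (s : R) (A : set R) : measurable A ->
  pushforward leb ((fun r => s + r) : R -> measurableTypeR R) A = leb A.
Proof.
have ms : measurable_fun setT ((fun r => s + r) : R -> measurableTypeR R).
  exact: measurable_funD.
move=> mA; apply/esym.
have key (B : set R) : ocitv B ->
    leb B = pushforward leb ((fun r => s + r) : R -> measurableTypeR R) B.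
  case=> [[a b]] _ <-; rewrite /pushforward.
  have -> : (fun r => s + r) @^-1` `]a, b]%classic = `]a - s, b - s]%classic.
    by apply/seteqP; split => r /=; rewrite !in_itv/= ltrBlDl lerBrDl.
  rewrite !lebesgue_measure_itv/= !lte_fin ltrD2r.
  by case: ifP => // _; rewrite -!EFinB; congr (_%:E); ring.
apply: lebesgue_measure_unique => //.
Qed.

Lemma integral_translate (f : R -> \bar R) (s l : R) :
  measurable_fun setT f -> (forall r, 0 <= f r)%E ->
  (\int[leb]_(r in `[0%R, l]) f (s + r)%R = \int[leb]_(r in `[s, (s + l)%R]) f r)%E.
Proof.
move=> mf f0.
have ms : measurable_fun setT ((fun r => s + r) : R -> measurableTypeR R).
  exact: measurable_funD.
have -> : `[0%R, l]%classic = ((fun r => s + r) : R -> measurableTypeR R) @^-1` `[s, s + l]%classic.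
  by apply/seteqP; split => r /=; rewrite !in_itv/= lerD2l lerDl.
rewrite -ge0_integral_pushforward//=; last exact: measurable_funS mf.
by apply: eq_measure_integral => //= A mA AS; exact: lebesgue_measure_translate.
Qed.

Lemma integral_itvD (f : R -> \bar R) (x y z : R) :
  measurable_fun setT f -> (forall r, 0 <= f r)%E -> x <= y -> y <= z ->
  (\int[leb]_(r in `[x, z]) f r =
   \int[leb]_(r in `[x, y]) f r + \int[leb]_(r in `[y, z]) f r)%E.
Proof.
move=> mf f0 xy yz.
rewrite -(@integral_itv_obnd_cbnd _ y (BRight z))//; last exact: measurable_funS mf.
rewrite -ge0_integral_setU//=.
- by congr (integral _ _ _); rewrite -itv_bndbnd_setU// bnd_simp.
- exact: measurable_funS mf.
- apply/disj_setPS => r [] /=; rewrite !in_itv/= => /andP[_ ry] /andP[yr _].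
  by move: yr; rewrite ltNge ry.
Qed.

(** Cutting [0, l] into N equal pieces leaves a total error of
    N K (l / N)^2 = K l^2 / N, which is arbitrarily small. *)
Lemma telescoping_quadratic_error (f H : R -> R) (l K : R) : 0 <= l ->
  measurable_fun setT H -> (forall r, 0 <= H r) ->
  (forall s t, 0 <= s -> s <= t -> t <= l ->
    ((`|f s - f t|)%:E <=
      \int[leb]_(r in `[s, t]) (H r)%:E + (K * (t - s) ^+ 2)%R%:E)%E) ->
  ((`|f 0 - f l|)%:E <= \int[leb]_(r in `[0%R, l]) (H r)%:E)%E.
Proof.
move=> l0 mH H0 step.
have mH' : measurable_fun setT (EFin \o H) by exact/measurable_EFinP.
have H0' r : (0 <= (EFin \o H) r)%E by rewrite lee_fin.
apply/lee_addgt0Pr => e e0.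
pose N := (Num.truncn (K * l ^+ 2 / e)).+1.
have N0 : 0 < N%:R :> R by rewrite ltr0n.
pose h := l / N%:R.
have h0 : 0 <= h by rewrite divr_ge0// ltW.
have hl k : (k <= N)%N -> k%:R * h <= l.
  move=> kN; rewrite /h mulrA ler_pdivrMr// mulrC ler_wpM2l// ler_nat//.
have key k : (k <= N)%N -> ((`|f 0 - f (k%:R * h)|)%R%:E <=
    \int[leb]_(r in `[0%R, (k%:R * h)%R]) (H r)%:E + (k%:R * (K * h ^+ 2))%R%:E)%E.
  elim: k => [_|k IH kN].
    by rewrite !mul0r subrr normr0 adde0; apply: integral_ge0 => r _; rewrite lee_fin.
  have kh0 : 0 <= k%:R * h by rewrite mulr_ge0.
  have kSh : k%:R * h <= k.+1%:R * h by rewrite ler_wpM2r// ler_nat.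
  rewrite (integral_itvD mH' H0' kh0 kSh).
  apply: (@le_trans _ _ ((`|f 0 - f (k%:R * h)|)%:E +
      (`|f (k%:R * h) - f (k.+1%:R * h)|)%:E)%E).
    by rewrite -EFinD lee_fin ler_distD.
  apply: le_trans (leeD (IH (ltnW kN)) (step _ _ kh0 kSh (hl _ kN))) _.
  rewrite addeACA leeD2l//= -EFinD lee_fin -mulrBl -natrB// subSnn mul1r.
  by rewrite -[k.+1]addn1 natrD mulrDl mul1r.
have := key N (leqnn _).
have -> : N%:R * h = l by rewrite /h mulrC divfK// gt_eqF.
move/le_trans; apply; rewrite leeD2l// lee_fin.
have -> : N%:R * (K * h ^+ 2) = K * l ^+ 2 / N%:R.
  by rewrite /h; field; rewrite gt_eqF.
rewrite ler_pdivrMr// -ler_pdivrMl// mulrC; apply/ltW.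
exact: truncnS_gt.
Qed.

End real_integrals.

(** * Arc length parametrization *)

Section arclength.
Context {R : realType} {d : measure_display} {X : metricMeasurableType d R}.
Implicit Types (gamma : curve X) (x y : X) (u g : X -> R).

Lemma len_ge0 gamma : 0 <= len gamma.
Proof. by rewrite fine_ge0// length_on_ge0// curve_le. Qed.

Local Notation lo := curve_lo.
Local Notation hi := curve_hi.
Local Notation lt gamma s := (last_time (lo gamma) (hi gamma) gamma s).

Lemma arclength_lipschitz gamma s t : 0 <= s -> s <= t -> t <= len gamma ->
  mdist (arclength_param gamma s) (arclength_param gamma t) <= t - s.
Proof.
move=> s0 st tl.
have ab := curve_le gamma; have cc := @curve_continuous _ _ gamma.
have rect := curve_rectifiable gamma.
have [s1 s2 s3 s4] := last_timeP ab cc rect s0 (le_trans st tl).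
have [t1 t2 t3 t4] := last_timeP ab cc rect (le_trans s0 st) tl.
have h : lt gamma s <= lt gamma t by apply: t4 => //; rewrite s3.
by apply: le_trans (running_length_mdist rect s1 h t2) _; rewrite s3 t3.
Qed.

Lemma arclength_lo gamma : arclength_param gamma 0 = gamma (lo gamma).
Proof.
have ab := curve_le gamma; have cc := @curve_continuous _ _ gamma.
have rect := curve_rectifiable gamma.
have [s1 s2 s3 s4] := last_timeP ab cc rect (lexx 0) (len_ge0 gamma).
apply/esym/mdist_positivity/eqP; rewrite eq_le mdist_ge0 andbT.
have := running_length_mdist rect (lexx _) s1 s2.
by rewrite s3 running_length_a subrr.
Qed.

Lemma arclength_hi gamma : arclength_param gamma (len gamma) = gamma (hi gamma).
Proof.
have ab := curve_le gamma; have cc := @curve_continuous _ _ gamma.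
have rect := curve_rectifiable gamma.
have [s1 s2 s3 s4] := last_timeP ab cc rect (len_ge0 gamma) (lexx _).
apply/mdist_positivity/eqP; rewrite eq_le mdist_ge0 andbT.
have := running_length_mdist rect s1 s2 (lexx _).
by rewrite s3 subrr.
Qed.

(** Both sides evaluate the curve at the last time at which a given length is
    reached, and by additivity of length the two conditions on the time agree.
    Thus an upper gradient can be tested on any piece of a curve. *)
Lemma subcurve gamma s t : 0 <= s -> s <= t -> t <= len gamma ->
  exists sigma : curve X, len sigma = t - s /\
    forall r, 0 <= r -> r <= t - s ->
      arclength_param sigma r = arclength_param gamma (s + r).
Proof.
move=> s0 st tl.
have ab := curve_le gamma; have cc := @curve_continuous _ _ gamma.
have rect := curve_rectifiable gamma.
have [s1 s2 s3 s4] := last_timeP ab cc rect s0 (le_trans st tl).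
have [t1 t2 t3 t4] := last_timeP ab cc rect (le_trans s0 st) tl.
have h : lt gamma s <= lt gamma t by apply: t4 => //; rewrite s3.
have c1 : {within `[lt gamma s, lt gamma t], continuous gamma}.
  apply: continuous_subspaceW cc.
  by apply: subset_itv; rewrite bnd_simp.
have c2 : (length_on (lt gamma s) (lt gamma t) gamma < +oo)%E.
  by rewrite (running_lengthB rect)// ltry.
exists (Curve h c1 c2); split.
  by rewrite /len/= (running_lengthB rect)//= s3 t3.
move=> r r0 rts; rewrite /arclength_param/=; congr (gamma _).
have sr0 : 0 <= s + r by rewrite addr_ge0.
have srt : s + r <= t by rewrite -lerBrDl.
have [q1 q2 q3 q4] := last_timeP ab cc rect sr0 (le_trans srt tl).
rewrite -[RHS]/(lt gamma (s + r)).
have sq : lt gamma s <= lt gamma (s + r) by apply: q4 => //; rewrite s3 lerDl.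
have qt : lt gamma (s + r) <= lt gamma t by apply: t4 => //; rewrite q3.
set S := (X in sup X = _).
have mem : S (lt gamma (s + r)).
  rewrite /S/= sq qt; split => //.
  by rewrite (running_lengthB rect)// q3 s3 addrAC subrr add0r.
have ub : ubound S (lt gamma (s + r)).
  move=> y [/andP[y1 y2]].
  have y3 := le_trans s1 y1; have y4 := le_trans y2 t2.
  rewrite (running_lengthB rect)// => -[/eqP]; rewrite s3 subr_eq => /eqP e.
  by apply: q4 => //; rewrite e addrC.
apply/eqP; rewrite eq_le; apply/andP; split.
  by apply: ge_sup => //; exists (lt gamma (s + r)).
by apply: ub_le_sup => //; exists (lt gamma (s + r)).
Qed.

(** Clamping the parameter makes the parametrization 1-Lipschitz on the whole
    line, so that it can be composed with Borel functions without restricting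
    to an interval. *)
Definition arc gamma (s : R) : X :=
  arclength_param gamma (Num.max 0 (Num.min s (len gamma))).

Lemma arcE gamma s : 0 <= s -> s <= len gamma -> arc gamma s = arclength_param gamma s.
Proof. by move=> s0 sl; rewrite /arc (min_idPl sl) (max_idPr s0). Qed.

Lemma arc_lipschitz gamma s t : mdist (arc gamma s) (arc gamma t) <= `|s - t|.
Proof.
wlog st : s t / s <= t.
  move=> H; have [/H//|/ltW/H] := leP s t.
  by rewrite metric_sym distrC.
have l0 := len_ge0 gamma.
rewrite distrC ger0_norm ?subr_ge0//.
apply: le_trans (arclength_lipschitz _ _ _) _.
- by rewrite le_max lexx.
- set l := len gamma in l0 *.
  by case: (leP s l) => ?; case: (leP t l) => ?; case: (leP 0 s) => ?; case: (leP 0 t) => ?; case: (leP 0 l) => ?; lra.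
- by rewrite ge_max l0/= ge_min lexx orbT.
set l := len gamma in l0 *.
by case: (leP s l) => ?; case: (leP t l) => ?; case: (leP 0 s) => ?; case: (leP 0 t) => ?; case: (leP 0 l) => ?; lra.
Qed.

Lemma arc_continuous gamma : continuous (arc gamma : R -> X).
Proof.
move=> s; apply/metricType_numDomainType.cvgrPdist_lt => e e0.
apply/nbhs_ballP; exists e => //= t st.
exact: le_lt_trans (arc_lipschitz _ _ _) st.
Qed.

Lemma arc_measurable gamma (g : X -> R) : Borel_fun g ->
  measurable_fun setT (g \o arc gamma).
Proof.
move=> mg.
have mc : measurable_fun setT (arc gamma : R -> g_sigma_algebraType (@open X)).
  apply: (@measurability _ _ (measurableTypeR R) (g_sigma_algebraType (@open X)) setT (arc gamma) (@open X)) => // _ [U oU <-].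
  rewrite setTI; apply: open_measurable.
  by move/continuousP : (@arc_continuous gamma); exact.
exact: (@measurableT_comp _ _ _ (measurableTypeR R) (g_sigma_algebraType (@open X)) _ g setT (arc gamma) mg mc).
Qed.

Lemma path_integralE g gamma : path_integral g gamma =
  (\int[lebesgue_measure]_(s in `[0%R, len gamma]) (g (arc gamma s))%:E)%E.
Proof.
apply: eq_integral => s; rewrite inE/= in_itv/= => /andP[s0 sl].
by rewrite arcE.
Qed.

Lemma upper_gradient_arc u g gamma s t : upper_gradient u g ->
  0 <= s -> s <= t -> t <= len gamma ->
  ((`|u (arc gamma s) - u (arc gamma t)|)%:E <=
     \int[lebesgue_measure]_(r in `[s, t]) (g (arc gamma r))%:E)%E.
Proof.
move=> [mg g0 ug] s0 st tl.
have ts0 : 0 <= t - s by rewrite subr_ge0.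
have [sigma [lsig psig]] := subcurve s0 st tl.
have := ug sigma.
rewrite -arclength_lo -arclength_hi lsig !psig// addr0 addrCA subrr addr0.
rewrite -!arcE//; try by [exact: le_trans tl|exact: le_trans st].
move=> /le_trans; apply.
rewrite /path_integral lsig.
have -> : (\int[lebesgue_measure]_(s0 in `[0%R, (t - s)%R]) (g (arclength_param sigma s0))%:E =
  \int[lebesgue_measure]_(r in `[0%R, (t - s)%R]) ((fun r => (g (arc gamma r))%:E) (s + r)%R))%E.
  apply: eq_integral => r; rewrite inE/= in_itv/= => /andP[r0 rl].
  rewrite psig// arcE ?addr_ge0//.
  by apply: le_trans tl; rewrite -lerBrDl.
rewrite (@integral_translate _ (fun r => (g (arc gamma r))%:E))//; last 2 first.
- by apply/measurable_EFinP; exact: arc_measurable.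
- by move=> r; rewrite lee_fin.
by rewrite addrCA subrr addr0.
Qed.

End arclength.

(** * Calculus of upper gradients *)

Section upper_gradient_calculus.
Context {R : realType} {d : measure_display} {X : metricMeasurableType d R}.
Implicit Types (u v g a b : X -> R).

Lemma lipschitz_continuous u : lipschitz_fun u -> continuous u.
Proof.
move=> [L L0 uL] x; apply/cvgrPdist_lt => e e0.
have L1 : 0 < L + 1 by rewrite ltr_wpDl.
apply/nbhs_ballP; exists (e / (L + 1)); first by rewrite /= divr_gt0.
move=> y; rewrite ballEmdist/= ltr_pdivlMr// => xy.
apply: le_lt_trans (uL x y) _; apply: le_lt_trans xy.
by rewrite mulrC ler_wpM2l ?mdist_ge0// lerDl.
Qed.

Lemma continuous_Borel_fun u : continuous u -> Borel_fun u.
Proof.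
move=> cu.
apply: (@measurability _ _ (g_sigma_algebraType (@open X)) _ setT u _
  (RGenOpens.measurableE R)) => _ [_ [x [y ->]] <-].
rewrite setTI; apply: sub_sigma_algebra.
by move/continuousP : cu; apply; exact: interval_open.
Qed.

Lemma lipschitz_Borel_fun u : lipschitz_fun u -> Borel_fun u.
Proof. by move=> /lipschitz_continuous/continuous_Borel_fun. Qed.

Lemma Borel_funD u v : Borel_fun u -> Borel_fun v -> Borel_fun (u \+ v).
Proof. exact: measurable_funD. Qed.

Lemma Borel_funM u v : Borel_fun u -> Borel_fun v -> Borel_fun (u \* v).
Proof. exact: measurable_funM. Qed.

Local Notation leb := (@lebesgue_measure R).

(** Truncations and products with functions of the distance satisfy such an
    estimate.  On a short piece of a curve the Lipschitz coefficients [a] and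
    [b] may be replaced by their values along the piece, at the cost of another
    quadratic error, and [telescoping_quadratic_error] removes all quadratic
    errors.  Requiring [a] and [b] to be Lipschitz is what spares any
    differentiation along the curve. *)
Lemma upper_gradient_rule u v g a b (M K : R) :
  upper_gradient u g -> (forall x, g x <= M) ->
  (forall x, 0 <= a x) -> lipschitz_fun a ->
  (forall x, 0 <= b x) -> lipschitz_fun b -> 0 <= K ->
  (forall x y, `|v x - v y| <=
    a x * `|u x - u y| + b x * mdist x y + K * mdist x y ^+ 2) ->
  upper_gradient v (fun x => a x * g x + b x).
Proof.
move=> ug gM a0 lipa b0 lipb K0 vu.
have [mg g0 _] := ug.
have [La La0 aL] := lipa; have [Lb Lb0 bL] := lipb.
have mG : Borel_fun (fun x => a x * g x + b x).
  apply: Borel_funD; last exact: lipschitz_Borel_fun.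
  by apply: Borel_funM => //; exact: lipschitz_Borel_fun.
have G0 x : 0 <= a x * g x + b x by rewrite addr_ge0 ?mulr_ge0.
split => // gamma.
rewrite -arclength_lo -arclength_hi path_integralE.
have l0 := len_ge0 gamma.
rewrite -(arcE (lexx 0) l0) -(arcE l0 (lexx _)).
pose C := La * M + Lb.
refine (@telescoping_quadratic_error _ (v \o arc gamma)
  (fun s => a (arc gamma s) * g (arc gamma s) + b (arc gamma s)) _ (K + C) l0 _ _ _) => //.
- exact: (arc_measurable gamma mG).
move=> s t s0 st tl /=.
have ts0 : 0 <= t - s by rewrite subr_ge0.
set x := arc gamma s; set y := arc gamma t.
have xy : mdist x y <= t - s.
  by apply: le_trans (arc_lipschitz _ _ _) _; rewrite distrC ger0_norm.
have mI : measurable (`[s, t]%classic : set (measurableTypeR R)) by [].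
have mgc : measurable_fun `[s, t] (fun r => (g (arc gamma r))%:E).
  by apply/measurable_EFinP; apply: measurable_funTS; exact: arc_measurable.
have mGc : measurable_fun `[s, t] (fun r =>
    (a (arc gamma r) * g (arc gamma r) + b (arc gamma r))%:E).
  by apply/measurable_EFinP; apply: measurable_funTS; exact: (arc_measurable gamma mG).
have leI : leb `[s, t] = (t - s)%:E.
  rewrite lebesgue_measure_itv/= lte_fin; case: ltP => [_|ts]; first by rewrite EFinB.
  by have /eqP -> : t == s by [rewrite eq_le ts st]; rewrite subrr.
have step1 : ((`|v x - v y|)%:E <= (a x)%:E *
    (\int[leb]_(r in `[s, t]) (g (arc gamma r))%:E) + (b x * (t - s))%R%:E
    + (K * (t - s) ^+ 2)%R%:E)%E.
  apply: (@le_trans _ _ ((a x)%:E * (`|u x - u y|)%:E + (b x * (t - s))%R%:E +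
     (K * (t - s) ^+ 2)%R%:E)%E); last first.
    rewrite leeD2r// leeD2r//; apply: lee_wpmul2l; first by rewrite lee_fin.
    exact: upper_gradient_arc.
  rewrite -EFinM -!EFinD lee_fin; apply: le_trans (vu x y) _.
  by rewrite lerD ?lerD// ?ler_wpM2l// lerXn2r ?nnegrE ?mdist_ge0.
apply: (le_trans step1).
rewrite mulrDl EFinD [(K * _)%:E + _]addeC addeA leeD2r//.
rewrite -ge0_integralZl_EFin//; last by move=> r _; rewrite lee_fin.
have -> : ((b x * (t - s))%R%:E = \int[leb]_(r in `[s, t]) (b x)%:E)%E.
  by rewrite integral_cst// EFinM; congr (_ * _)%E; exact/esym/leI.
have -> : ((C * (t - s) ^+ 2)%R%:E = \int[leb]_(r in `[s, t]) (C * (t - s))%R%:E)%E.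
  by rewrite integral_cst// expr2 mulrA EFinM; congr (_ * _)%E; exact/esym/leI.
have M0 : 0 <= M by exact: le_trans (g0 x) (gM x).
have C0 : 0 <= C by rewrite addr_ge0// mulr_ge0.
rewrite -!ge0_integralD//.
- apply: ge0_le_integral => //.
  + by move=> r _; rewrite lee_fin addr_ge0// mulr_ge0.
  + apply: emeasurable_funD => //.
    by apply: emeasurable_funM.
  + exact: emeasurable_funD.
  move=> r /=; rewrite in_itv/= => /andP[sr rt].
  rewrite -EFinM -!EFinD lee_fin /C.
  have xr : mdist x (arc gamma r) <= t - s.
    apply: le_trans (arc_lipschitz _ _ _) _; rewrite distrC ger0_norm ?subr_ge0//.
    by rewrite lerD2r.
  have {}aL : a x <= a (arc gamma r) + La * (t - s).
    have := aL x (arc gamma r); rewrite ler_norml => /andP[_].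
    by rewrite lerBlDl => /le_trans; apply; rewrite lerD2l ler_wpM2l.
  have {}bL : b x <= b (arc gamma r) + Lb * (t - s).
    have := bL x (arc gamma r); rewrite ler_norml => /andP[_].
    by rewrite lerBlDl => /le_trans; apply; rewrite lerD2l ler_wpM2l.
  have gr := g0 (arc gamma r); have gMr := gM (arc gamma r).
  apply: (@le_trans _ _ ((a (arc gamma r) + La * (t - s)) * g (arc gamma r) + (b (arc gamma r) + Lb * (t - s)))).
    by apply: lerD => //; exact: ler_wpM2r.
  have : La * (t - s) * g (arc gamma r) <= La * (t - s) * M.
    by rewrite ler_wpM2l// mulr_ge0.
  rewrite !mulrDl; lra.
- by move=> r _; rewrite lee_fin.
- by move=> r _; rewrite lee_fin mulr_ge0.
- by move=> r _; rewrite -EFinM lee_fin mulr_ge0.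
- exact: emeasurable_funM.
- by move=> r _; rewrite lee_fin.
Qed.

End upper_gradient_calculus.

(** * Truncation between two levels *)

Section truncation.
Context {R : realType}.
Implicit Types (s z : R).

Definition level_trunc s z : R := Num.max 0 (Num.min (`|z| - s) s).

(** A Lipschitz majorant of the indicator of s <= |z| <= 2 s, which is where
    [level_trunc s] has slope 1; it decreases to 0 within distance s / 2 of that
    set. *)
Definition level_bump s z : R :=
  Num.max 0 (1 - 2 / s * Num.max 0 (Num.max (s - `|z|) (`|z| - 2 * s))).

Lemma lipschitz_max0 (x y : R) : `|Num.max 0 x - Num.max 0 y| <= `|x - y|.
Proof.
case: (leP 0 x) => ?; case: (leP 0 y) => ?; rewrite ?subrr ?normr0//.
  by rewrite subr0 !ger0_norm; lra.
by rewrite sub0r normrN [leRHS]distrC !ger0_norm; lra.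
Qed.

Lemma lipschitz_maxmin (s x y : R) :
  `|Num.max (s - x) (x - 2 * s) - Num.max (s - y) (y - 2 * s)| <= `|x - y|.
Proof.
rewrite ler_norml; have := ler_norm (x - y); have := ler_norm (y - x).
rewrite distrC.
by case: (leP (s - x)) => ?; case: (leP (s - y)) => ? ? ?; apply/andP; split; lra.
Qed.

Lemma level_trunc_lipschitz s x y : `|level_trunc s x - level_trunc s y| <= `|x - y|.
Proof.
apply: le_trans (lipschitz_max0 _ _) _.
apply: le_trans (ler_dist_dist x y).
rewrite ler_norml; have := ler_norm (`|x| - `|y|); have := ler_norm (`|y| - `|x|).
rewrite distrC.
by case: (leP (`|x| - s)) => ?; case: (leP (`|y| - s)) => ? ? ?; apply/andP; split; lra.
Qed.

Lemma level_trunc_lo s z : 0 <= s -> `|z| <= s -> level_trunc s z = 0.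
Proof.
move=> s0 zs; apply: max_l; rewrite ge_min; apply/orP; left.
by rewrite subr_le0.
Qed.

Lemma level_trunc_hi s z : 0 <= s -> 2 * s <= `|z| -> level_trunc s z = s.
Proof.
move=> s0 zs; rewrite /level_trunc min_r; last by lra.
exact: max_r.
Qed.

Lemma level_bump_lipschitz s x y : 0 < s ->
  `|level_bump s x - level_bump s y| <= 2 / s * `|x - y|.
Proof.
move=> s0; apply: le_trans (lipschitz_max0 _ _) _.
have e12 (k e e' : R) : 1 - k * e - (1 - k * e') = k * (e' - e) by ring.
rewrite e12 normrM ger0_norm; last by rewrite divr_ge0// (ltW s0).
rewrite ler_wpM2l ?divr_ge0 ?(ltW s0)// distrC.
apply: le_trans (lipschitz_max0 _ _) _.
by apply: le_trans (lipschitz_maxmin _ _ _) _; exact: ler_dist_dist.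
Qed.

Lemma level_bump_ge0 s x : 0 <= level_bump s x.
Proof. by rewrite le_max lexx. Qed.

Lemma level_bump_le1 s x : 0 < s -> level_bump s x <= 1.
Proof.
by move=> s0; rewrite ge_max ler01/= gerBl mulr_ge0 ?divr_ge0 ?le_max ?lexx// (ltW s0).
Qed.

Lemma level_bump_supp s x : 0 < s -> level_bump s x != 0 -> s < 2 * `|x| < 5 * s.
Proof.
move=> s0; rewrite /level_bump; set e := Num.max 0 (Num.max _ _).
case: (leP 0 (1 - 2 / s * e)) => [h0 h|]; last by rewrite eqxx.
have {h}h0 : 2 * e < s.
  have : 0 < 1 - 2 / s * e by rewrite lt_neqAle eq_sym h.
  by rewrite subr_gt0 mulrAC ltr_pdivrMr// mul1r.
have h1 : s - `|x| <= e by rewrite !le_max lexx !orbT.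
have h2 : `|x| - 2 * s <= e by rewrite !le_max lexx !orbT.
by apply/andP; split; lra.
Qed.

(** With [e] the distance from |x| to [s, 2 s]: if |x - y| < e then |x| and |y|
    lie on the same side of that interval and the truncations agree; otherwise
    1 - 2 e / s <= level_bump s x loses at most (2 / s) |x - y|^2. *)
Lemma level_trunc_rule s x y : 0 < s ->
  `|level_trunc s x - level_trunc s y| <=
  level_bump s x * `|x - y| + 2 / s * `|x - y| ^+ 2.
Proof.
move=> s0; set e := Num.max 0 (Num.max (s - `|x|) (`|x| - 2 * s)).
have e0 : 0 <= e by rewrite le_max lexx.
have eb : 1 - 2 / s * e <= level_bump s x by rewrite le_max lexx orbT.
have [lt_e|e_le] := ltP `|x - y| e.
  suff -> : level_trunc s x = level_trunc s y.
    by rewrite subrr normr0 addr_ge0 ?mulr_ge0 ?level_bump_ge0 ?invr_ge0 ?exprn_ge0 ?(ltW s0).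
  have := ler_dist_dist x y; rewrite ler_norml => /andP[h1 h2].
  have : e <= s - `|x| \/ e <= `|x| - 2 * s.
    have : 0 < e by exact: le_lt_trans lt_e.
    rewrite /e; case: (leP (s - `|x|) (`|x| - 2 * s)) => _; case: (leP 0) => h3.
    - by right.
    - by rewrite ltxx.
    - by left.
    - by rewrite ltxx.
  case=> h; first by rewrite !level_trunc_lo//; lra.
  by rewrite !level_trunc_hi//; lra.
apply: le_trans (level_trunc_lipschitz s x y) _.
apply: (@le_trans _ _ ((1 - 2 / s * e) * `|x - y| + 2 / s * `|x - y| ^+ 2)); last first.
  by rewrite lerD2r ler_wpM2r.
rewrite -subr_ge0.
have -> : forall k D : R, (1 - k * e) * D + k * D ^+ 2 - D = k * ((D - e) * D) by move=> *; ring.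
by rewrite !mulr_ge0 ?invr_ge0 ?subr_ge0 ?(ltW s0).
Qed.

End truncation.

(** * Logarithmic cut-off *)

Section log_cutoff.
Context {R : realType}.
Implicit Types (N : nat) (t r : R).

(** Equal to 0 for r <= t 2^-N, to 1 for r >= t, and linear in [ln r] in
    between. *)
Definition log_cutoff N t r : R :=
  Num.min 1 (1 + ln (Num.max r (t / 2 ^+ N) / t) / (N%:R * ln 2)).

Lemma lipschitz_maxr (c x y : R) : `|Num.max x c - Num.max y c| <= `|x - y|.
Proof.
rewrite ler_norml; have := ler_norm (x - y); have := ler_norm (y - x).
rewrite distrC.
by case: (leP x c) => ?; case: (leP y c) => ? ? ?; apply/andP; split; lra.
Qed.

Lemma ln_diff_le (x y : R) : 0 < y -> y <= x -> ln x - ln y <= (x - y) / y.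
Proof.
move=> y0 yx; have x0 := lt_le_trans y0 yx.
rewrite -ln_div// mulrBl divff ?gt_eqF//.
have h := @le_ln1Dx R (x / y - 1).
by rewrite -[X in ln X](subrKC 1) h// ltrBrDr addNr divr_gt0.
Qed.

Lemma ln2_gt0 : 0 < ln (2 : R).
Proof. by rewrite ln_gt0// ltr1n. Qed.

Variables (N : nat) (t : R).
Hypotheses (N0 : (0 < N)%N) (t0 : 0 < t).

Let delta : R := t / 2 ^+ N.
Let beta : R := (N%:R * ln 2)^-1.
Let m r : R := Num.max r delta.

Let delta0 : 0 < delta. Proof. by rewrite divr_gt0// exprn_gt0. Qed.

Let beta0 : 0 < beta.
Proof. by rewrite invr_gt0 mulr_gt0 ?ltr0n// ln2_gt0. Qed.

Let Nl0 : 0 < N%:R * ln 2 :> R. Proof. by rewrite mulr_gt0 ?ltr0n// ln2_gt0. Qed.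

Let m0 r : 0 < m r. Proof. by rewrite lt_max delta0 orbT. Qed.

Let ln_delta : ln (delta / t) = - (N%:R * ln 2).
Proof.
rewrite /delta mulrAC divff ?gt_eqF// mul1r lnV ?posrE ?exprn_gt0//.
by rewrite lnXn// mulr_natl.
Qed.

Lemma log_cutoff_le1 r : log_cutoff N t r <= 1.
Proof. by rewrite ge_min lexx. Qed.

Lemma log_cutoff_ge0 r : 0 <= log_cutoff N t r.
Proof.
rewrite le_min ler01/=.
have : ln (delta / t) <= ln (m r / t).
  by rewrite ler_ln ?posrE ?divr_gt0// ler_pM2r ?invr_gt0// le_max lexx orbT.
rewrite ln_delta.
move=> h; rewrite -lerBlDl sub0r ler_pdivlMr// mulN1r.
exact: h.
Qed.

Lemma log_cutoff_eq0 r : r <= t / 2 ^+ N -> log_cutoff N t r = 0.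
Proof.
move=> rd; rewrite /log_cutoff (max_r rd) ln_delta mulNr divff ?gt_eqF//.
by rewrite subrr min_r.
Qed.

Lemma log_cutoff_ge_half r : (2 <= N)%N -> t / 2 <= r -> 2^-1 <= log_cutoff N t r.
Proof.
move=> N2 tr; rewrite le_min; apply/andP; split; first by rewrite invf_le1 ?ler1n.
have : ln (2^-1) <= ln (m r / t).
  rewrite ler_ln ?posrE ?divr_gt0 ?invr_gt0//.
  by rewrite ler_pdivlMr// mulrC le_max tr.
rewrite lnV ?posrE// => h.
have h2 : - ln 2 / (N%:R * ln 2) <= ln (m r / t) / (N%:R * ln 2).
  by rewrite ler_pM2r ?invr_gt0.
apply: le_trans (lerD (lexx 1) h2).
rewrite invfM mulNr mulrCA divff ?gt_eqF ?ln2_gt0// mulr1.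
have : (N%:R : R)^-1 <= 2^-1 by rewrite lef_pV2 ?posrE ?ltr0n// ler_nat.
by lra.
Qed.

Let ln_m (r r' : R) : `|ln (m r) - ln (m r')| <= `|r - r'| / Num.min (m r) (m r').
Proof.
wlog le : r r' / m r' <= m r.
  move=> H; have /orP[/H//|/H] := le_total (m r') (m r).
  by move=> h; rewrite distrC (distrC r) minC.
rewrite min_r// ger0_norm; last by rewrite subr_ge0 ler_ln ?posrE.
apply: le_trans (ln_diff_le (m0 _) le) _.
rewrite ler_pM2r ?invr_gt0//; apply: le_trans (ler_norm _) _.
exact: lipschitz_maxr.
Qed.

Let log_cutoff_ln (r r' : R) : `|log_cutoff N t r - log_cutoff N t r'| <=
  beta * `|ln (m r) - ln (m r')|.
Proof.
rewrite /log_cutoff -/delta -/(m r) -/(m r').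
have min1 (x y : R) : `|Num.min 1 x - Num.min 1 y| <= `|x - y|.
  rewrite ler_norml; have := ler_norm (x - y); have := ler_norm (y - x).
  rewrite distrC.
  by case: (leP 1 x) => ?; case: (leP 1 y) => ? ? ?; apply/andP; split; lra.
apply: le_trans (min1 _ _) _.
rewrite !ln_div ?posrE//.
have -> (x y z : R) : 1 + (x - z) / (N%:R * ln 2) - (1 + (y - z) / (N%:R * ln 2)) =
    beta * (x - y) by rewrite -/beta; ring.
by rewrite normrM gtr0_norm.
Qed.

Lemma log_cutoff_min (r r' : R) : r' <= r ->
  `|log_cutoff N t r - log_cutoff N t r'| <= beta / m r' * `|r - r'|.
Proof.
move=> rr; apply: le_trans (log_cutoff_ln _ _) _.
rewrite -mulrA ler_pM2l// mulrC; apply: le_trans (ln_m _ _) _.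
rewrite min_r// /m ge_max le_max rr/= le_max lexx orbT//.
Qed.

Lemma log_cutoff_lipschitz (r r' : R) :
  `|log_cutoff N t r - log_cutoff N t r'| <= beta / delta * `|r - r'|.
Proof.
apply: le_trans (log_cutoff_ln _ _) _.
rewrite -mulrA ler_pM2l// mulrC; apply: le_trans (ln_m _ _) _.
rewrite ler_wpM2l// lef_pV2 ?posrE// ?lt_min ?m0//.
by rewrite le_min !le_max lexx !orbT.
Qed.

(** The slope at [r] is evaluated at [r] itself; passing from the minimum of
    the two arguments to [r] costs the quadratic term. *)
Lemma log_cutoff_slope (r r' : R) :
  `|log_cutoff N t r - log_cutoff N t r'| <=
  beta / m r * `|r - r'| + beta / (m r * delta) * `|r - r'| ^+ 2.
Proof.
apply: le_trans (log_cutoff_ln _ _) _.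
rewrite -!mulrA -mulrDr ler_pM2l//; apply: le_trans (ln_m _ _) _.
have ltm : `|m r - m r'| <= `|r - r'| by exact: lipschitz_maxr.
have dm : delta <= m r' by rewrite le_max lexx orbT.
have min0 : 0 < Num.min (m r) (m r') by rewrite lt_min !m0.
have : (Num.min (m r) (m r'))^-1 <= (m r)^-1 + (m r * delta)^-1 * `|r - r'|.
  have [le|lt] := leP (m r) (m r').
    by rewrite lerDl mulr_ge0// invr_ge0 mulr_ge0// ltW.
  have -> : (m r')^-1 = (m r)^-1 + (m r * m r')^-1 * (m r - m r').
    by field; rewrite !gt_eqF.
  rewrite lerD2l ler_pM// ?subr_ge0 ?(ltW lt)// ?invr_ge0 ?mulr_ge0 ?(ltW (m0 _))//.
    by rewrite lef_pV2 ?posrE ?mulr_gt0// ler_pM2l.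
  exact: le_trans (ler_norm _) ltm.
move=> h; apply: le_trans (ler_wpM2l (normr_ge0 _) h) _.
by rewrite mulrDr mulrC lerD2l expr2 mulrCA.
Qed.

End log_cutoff.

(** * Functions vanishing outside a domain *)

Section distance_to_complement.
Context {R : realType} {d : measure_display} {X : metricMeasurableType d R}.
Variable Omega : set X.
Hypothesis Omega_proper : Omega <> [set: X].
Local Notation D x := (dist_set x (~` Omega)).

Lemma setC_proper_neq0 : (~` Omega) !=set0.
Proof.
apply/set0P/eqP => C0; apply: Omega_proper.
by rewrite -(setCK Omega) C0 setC0.
Qed.

Lemma dist_set_le x y : (~` Omega) y -> D x <= mdist x y.
Proof.
move=> Oy; apply: ge_inf; last by exists y.
by exists 0 => _ [z _ <-]; exact: mdist_ge0.
Qed.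

Lemma le_dist_set x r : (forall y, (~` Omega) y -> r <= mdist x y) -> r <= D x.
Proof.
move=> H; apply: lb_le_inf; last by move=> _ [y Oy <-]; exact: H.
by have [y Oy] := setC_proper_neq0; exists (mdist x y); exists y.
Qed.

Lemma dist_set_ge0 x : 0 <= D x.
Proof. by apply: le_dist_set => y _; exact: mdist_ge0. Qed.

Lemma dist_set_lipschitz x y : `|D x - D y| <= mdist x y.
Proof.
wlog : x y / D y <= D x.
  move=> H; have /orP[/H//|/H] := le_total (D y) (D x).
  by rewrite distrC metric_sym.
move=> yx; rewrite ger0_norm ?subr_ge0// lerBlDl -lerBlDr.
apply: le_dist_set => z Oz; rewrite lerBlDr addrC.
by apply: le_trans (dist_set_le x Oz) _; exact: metric_triangle.
Qed.

Lemma dist_set_out x : ~ Omega x -> D x = 0.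
Proof.
move=> Ox; apply/eqP; rewrite eq_le dist_set_ge0 andbT.
by have := @dist_set_le x x Ox; rewrite mdistxx.
Qed.

Lemma dist_set_gt0 x : open Omega -> Omega x -> 0 < D x.
Proof.
rewrite openE => oO /oO /nbhs_ballP[e /= e0 eO].
apply: lt_le_trans e0 _; apply: le_dist_set => y Oy.
rewrite leNgt; apply/negP => xy; apply: Oy; apply: eO.
by rewrite ballEmdist.
Qed.

Lemma dist_set_gt0_in x : 0 < D x -> Omega x.
Proof. by apply: contraPP => /dist_set_out ->; rewrite ltxx. Qed.

Lemma dist_set_lipschitz_fun : lipschitz_fun (fun x => D x).
Proof. by exists 1 => // x y; rewrite mul1r; exact: dist_set_lipschitz. Qed.

Lemma Lip0_bound (u : X -> R) L x : (forall x y, `|u x - u y| <= L * mdist x y) ->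
  (forall x, ~ Omega x -> u x = 0) -> 0 <= L -> `|u x| <= L * D x.
Proof.
move=> uL u0 L0; have [y Oy] := setC_proper_neq0.
have [L00|Lp] := eqVneq L 0.
  by have := uL x y; rewrite L00 !mul0r (u0 y Oy) subr0.
have {}Lp : 0 < L by rewrite lt_neqAle eq_sym Lp.
rewrite -ler_pdivrMl//; apply: le_dist_set => z Oz.
by rewrite ler_pdivrMl//; have := uL x z; rewrite (u0 z Oz) subr0.
Qed.

Lemma trunc_Lip0 (v : X -> R) s : 0 < s -> Lip0 Omega v ->
  Lip0 Omega (fun x => level_trunc s (v x)).
Proof.
move=> s0 [[L L0 vL] v0]; split.
  exists L => // x y; apply: le_trans (level_trunc_lipschitz _ _ _) _; exact: vL.
move=> x Ox; rewrite v0// level_trunc_lo ?normr0//; exact: ltW.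
Qed.

(** [level_trunc_rule] is the estimate required by [upper_gradient_rule]. *)
Lemma trunc_upper_gradient (v g : X -> R) M s : 0 < s -> lipschitz_fun v ->
  upper_gradient v g -> (forall x, g x <= M) ->
  upper_gradient (fun x => level_trunc s (v x)) (fun x => level_bump s (v x) * g x).
Proof.
move=> s0 [L L0 vL] vg gM.
rewrite (_ : (fun x => _ * _) = (fun x => level_bump s (v x) * g x + 0)); last first.
  by apply/funext => x; rewrite addr0.
apply: (@upper_gradient_rule _ _ _ v _ g _ (cst 0) M (2 / s * L ^+ 2)) => //.
- by move=> x; exact: level_bump_ge0.
- exists (2 / s * L); first by rewrite mulr_ge0// divr_ge0// ltW.
  move=> x y; apply: le_trans (level_bump_lipschitz _ _ s0) _.
  by rewrite -[leRHS]mulrA ler_wpM2l// divr_ge0// ltW.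
- by exists 0 => // x y; rewrite subrr normr0 mul0r.
- by rewrite mulr_ge0 ?exprn_ge0// divr_ge0// ltW.
move=> x y; rewrite mul0r addr0.
apply: le_trans (level_trunc_rule _ _ s0) _; rewrite lerD2l -[leRHS]mulrA ler_wpM2l//.
  by rewrite divr_ge0// ltW.
by rewrite -exprMn lerXn2r ?nnegrE// mulr_ge0// mdist_ge0.
Qed.

Section cutoff.
Variables (N : nat) (t L M : R) (u g : X -> R).
Hypotheses (N0 : (0 < N)%N) (t0 : 0 < t) (L0 : 0 <= L).
Hypothesis uL : forall x y, `|u x - u y| <= L * mdist x y.
Hypothesis u0 : forall x, ~ Omega x -> u x = 0.
Hypothesis ug : upper_gradient u g.
Hypothesis gM : forall x, g x <= M.

Let delta : R := t / 2 ^+ N.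
Let beta : R := (N%:R * ln 2)^-1.
Let m x : R := Num.max (D x) delta.
Let phi x := log_cutoff N t (D x).

Let delta0 : 0 < delta. Proof. by rewrite divr_gt0// exprn_gt0. Qed.
Let beta0 : 0 < beta.
Proof. by rewrite invr_gt0 mulr_gt0 ?ltr0n// ln2_gt0. Qed.
Let m0 x : 0 < m x. Proof. by rewrite lt_max delta0 orbT. Qed.
Let um x : `|u x| <= L * m x.
Proof.
apply: le_trans (Lip0_bound x uL u0 L0) _.
by rewrite ler_wpM2l// le_max lexx.
Qed.

(** The product of [u] with the logarithmic cut-off of the distance, and the
    upper gradient that the product rule suggests for it. *)
Definition cutoff_fun x : R := u x * log_cutoff N t (D x).
Definition cutoff_gradient x : R := log_cutoff N t (D x) * g x +
  `|u x| * (beta / m x).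

(** Although [u] may be unbounded, |u| <= L D compensates for the slope of the
    cut-off, which is at most a multiple of 1 / D; the bound is taken at the
    point closer to the complement. *)
Lemma cutoff_Lip0 : Lip0 Omega cutoff_fun.
Proof.
split; last by move=> x Ox; rewrite /cutoff_fun u0// mul0r.
exists (L + L * beta); first by rewrite addr_ge0// mulr_ge0// ltW.
move=> x y; wlog yx : x y / D y <= D x.
  move=> H; have /orP[/H//|/H] := le_total (D y) (D x).
  by rewrite distrC metric_sym.
have -> : cutoff_fun x - cutoff_fun y = (u x - u y) * phi x + u y * (phi x - phi y).
  by rewrite /cutoff_fun /phi; ring.
apply: le_trans (ler_normD _ _) _; rewrite !normrM mulrDl lerD//.
  rewrite [`|phi x|]ger0_norm ?log_cutoff_ge0//.
  rewrite -[leRHS]mulr1 ler_pM ?log_cutoff_ge0 ?log_cutoff_le1//.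
apply: (@le_trans _ _ (L * m y * (beta / m y * mdist x y))).
  rewrite ler_pM//; apply: le_trans (log_cutoff_min N0 t0 yx) _.
  rewrite -/delta -/beta -/(m y) ler_wpM2l ?dist_set_lipschitz//.
  by rewrite divr_ge0// ltW.
rewrite le_eqVlt; apply/orP; left; apply/eqP; field.
by rewrite gt_eqF.
Qed.

(** The product rule, with the error terms made uniformly quadratic by
    |u| <= L m. *)
Lemma cutoff_upper_gradient : upper_gradient cutoff_fun cutoff_gradient.
Proof.
have bd0 : 0 <= beta / delta by rewrite divr_ge0// ltW.
have Lbd0 : 0 <= 2 * (L * (beta / delta)) by apply: mulr_ge0 => //; exact: mulr_ge0.
have lipphi x y : `|phi x - phi y| <= beta / delta * mdist x y.
  apply: le_trans (log_cutoff_lipschitz N0 t0 _ _) _.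
  by rewrite ler_wpM2l// dist_set_lipschitz.
apply: (@upper_gradient_rule _ _ _ u _ g _ (fun x => `|u x| * (beta / m x)) M
   (2 * (L * (beta / delta)))) => //.
- by move=> x; exact: log_cutoff_ge0.
- by exists (beta / delta).
- by move=> x; rewrite mulr_ge0// divr_ge0// ltW.
- exists (2 * (L * (beta / delta))).
    exact: Lbd0.
  move=> x y.
  have -> : `|u x| * (beta / m x) - `|u y| * (beta / m y) =
    (`|u x| - `|u y|) * (beta / m x) + `|u y| * (beta / (m x * m y)) * (m y - m x).
    by field; rewrite !gt_eqF.
  have dm : delta <= m x by rewrite le_max lexx orbT.
  have mm : `|m y - m x| <= mdist x y.
    apply: le_trans (dist_set_lipschitz x y).
    by rewrite distrC; exact: lipschitz_maxr.
  have bm : beta / m x <= beta / delta by rewrite ler_pM2l// lef_pV2 ?posrE.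
  have bm0 : 0 <= beta / m x by rewrite divr_ge0// ltW.
  apply: le_trans (ler_normD _ _) _.
  rewrite normrM [X in _ + X]normrM [X in _ + X * _]normrM.
  rewrite (_ : 2 * _ * _ = L * mdist x y * (beta / delta) + L * (beta / delta) * mdist x y); last by ring.
  rewrite lerD//.
    rewrite [`|beta / m x|]ger0_norm// ler_pM//.
    by apply: le_trans (ler_dist_dist _ _) _; exact: uL.
  rewrite ler_pM// ?mulr_ge0// normr_id [`|beta / _|]ger0_norm; last by rewrite divr_ge0 ?mulr_ge0 ?(ltW (m0 _)) ?(ltW beta0).
  apply: (@le_trans _ _ (L * m y * (beta / (m x * m y)))).
    by rewrite ler_wpM2r// divr_ge0 ?mulr_ge0 ?(ltW (m0 _)) ?(ltW beta0).
  rewrite (_ : L * m y * _ = L * (beta / m x)); last by field; rewrite !gt_eqF.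
  by rewrite ler_wpM2l.
move=> x y.
have -> : cutoff_fun x - cutoff_fun y =
   (u x - u y) * phi x + u x * (phi x - phi y) - (u x - u y) * (phi x - phi y).
  by rewrite /cutoff_fun /phi; ring.
apply: le_trans (ler_normB _ _) _.
apply: le_trans (lerD (ler_normD _ _) (lexx _)) _.
rewrite !normrM [`|phi x|]ger0_norm ?log_cutoff_ge0//.
rewrite [_ * phi x]mulrC -!addrA lerD2l.
rewrite (_ : 2 * _ * _ = L * (beta / delta) * mdist x y ^+ 2 + L * mdist x y * (beta / delta * mdist x y)); last by ring.
rewrite addrA lerD//; last by rewrite ler_pM.
apply: le_trans (ler_wpM2l (normr_ge0 (u x)) (log_cutoff_slope N0 t0 (D x) (D y))) _.
rewrite -/delta -/beta -/(m x) mulrDr lerD//.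
  rewrite -[leRHS]mulrA ler_wpM2l// ler_wpM2l ?dist_set_lipschitz//.
  by rewrite divr_ge0// ltW.
have sl0 : 0 <= beta / (m x * delta) by rewrite ltW// divr_gt0// mulr_gt0.
apply: (@le_trans _ _ (L * m x * (beta / (m x * delta) * mdist x y ^+ 2))).
  rewrite ler_pM//; first by rewrite mulr_ge0 ?exprn_ge0.
  by rewrite ler_wpM2l// lerXn2r ?nnegrE ?mdist_ge0// dist_set_lipschitz.
rewrite le_eqVlt; apply/orP; left; apply/eqP; field.
by rewrite !gt_eqF.
Qed.

Lemma cutoff_gradient_le x : cutoff_gradient x <= M + L * beta.
Proof.
have [_ g0 _] := ug.
rewrite /cutoff_gradient lerD//.
  apply: le_trans (gM x); rewrite -[leRHS]mul1r ler_wpM2r// log_cutoff_le1//.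
apply: (@le_trans _ _ (L * m x * (beta / m x))).
  by rewrite ler_wpM2r// divr_ge0// ltW.
by rewrite mulrCA -!mulrA divff ?gt_eqF// mulr1 mulrC.
Qed.

End cutoff.

End distance_to_complement.

(** * Covering by balls *)

Section covering.
Context {R : realType} {d : measure_display} {X : metricMeasurableType d R}.

(** Among disjoint subfamilies such that every ball meeting a chosen ball meets
    a chosen one of more than half its radius, take a maximal one.  A ball that
    met no chosen ball could be taken with nearly largest radius among such
    balls, and added. *)
Lemma vitali_metric (S : set X) (r : X -> R) (rho : R) :
  (forall x, S x -> 0 < r x <= rho) ->
  exists A : set X, [/\ A `<=` S, trivIset A (fun x => ball x (r x)) &
    forall x, S x -> exists2 y, A y & mdist y x < 3 * r y].
Proof.
move=> rS; pose B x := ball x (r x).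
pose P (A : set X) := [/\ A `<=` S, trivIset A B &
  forall x y, S x -> A y -> B x `&` B y !=set0 ->
    exists2 z, A z & B x `&` B z !=set0 /\ r x < 2 * r z].
have [A [[AS tA PA] maxA]] : exists A, P A /\ forall A', A `<` A' -> ~ P A'.
  apply: Zorn_bigcup => F FP tF; split.
  - by move=> x [A FA Ax]; have [AS _ _] := FP _ FA; exact: AS.
  - move=> x y [A FA Ax] [A' FA' A'y].
    have [AA'|A'A] := tF _ _ FA FA'.
      by have [_ tA' _] := FP _ FA'; apply: tA' => //; exact: AA'.
    by have [_ tA _] := FP _ FA; apply: tA => //; exact: A'A.
  - move=> x y Sx [A FA Ay] xy; have [_ _ PA] := FP _ FA.
    by have [z Az] := PA x y Sx Ay xy; exists z => //; exists A.
have meets x : S x -> exists2 y, A y & B x `&` B y !=set0.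
  move=> Sx; apply: contrapT => nx.
  (* the balls that meet no chosen ball *)
  pose T := [set x | S x /\ forall y, A y -> B x `&` B y = set0].
  have Tx : T x.
    split => // y Ay; apply: contrapT => /eqP/set0P h.
    by apply: nx; exists y.
  have rx0 : 0 < r x by have /andP[] := rS x Sx.
  have hs : has_sup [set r z | z in T].
    split; first by exists (r x); exists x.
    by exists rho => _ [z [Sz _] <-]; have /andP[] := rS z Sz.
  set sg := sup [set r z | z in T].
  have xs : r x <= sg by apply: ub_le_sup; [exact: hs.2|exists x].
  have sg0 : 0 < sg / 2 by rewrite divr_gt0// (lt_le_trans rx0).
  have [_ [z Tz <-]] := sup_adherent sg0 hs.
  rewrite -/sg => sz; have {}sz : sg < 2 * r z by lra.
  have rz0 : 0 < r z by lra.
  have Bzz : B z z by rewrite /B ballEmdist/= mdistxx.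
  have nAz : ~ A z.
    move=> Az; have := Tz.2 z Az; rewrite setIid => e0.
    by have : B z z by []; rewrite e0.
  apply: (maxA (A `|` [set z])).
    by split; [move=> y Ay; left|move=> h; apply: nAz; apply: h; right].
  split.
  - by move=> y [/AS//|->]; case: Tz.
  - move=> y y' [Ay|->] [Ay'|->] //.
    + exact: tA.
    + by rewrite setIC Tz.2// => -[].
    + by rewrite Tz.2// => -[].
  - move=> y y' Sy Ay' yy'.
    have [[y'' Ay'' h]|h] := pselect (exists2 y'', A y'' & B y `&` B y'' !=set0).
      have [t At ht] := PA y y'' Sy Ay'' h.
      by exists t => //; left.
    exists z; first by right.
    case: Ay' yy' => [Ay' yy'|-> yz]; first by exfalso; apply: h; exists y'.
    split => //; apply: le_lt_trans sz; apply: ub_le_sup; first exact: hs.2.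
    exists y => //; split => // t At; apply: contrapT => /eqP/set0P h'.
    by apply: h; exists t.
exists A; split => // x Sx.
have [y Ay xy] := meets x Sx.
have [z Az [[t [xt zt]] rxz]] := PA x y Sx Ay xy.
exists z => //.
move: xt zt; rewrite /B !ballEmdist/= => xt zt.
apply: le_lt_trans (metric_triangle z t x) _.
by rewrite (metric_sym t x); lra.
Qed.

Variable mu : {measure set X -> \bar R}.
Hypothesis open_mu : forall U : set X, open U -> measurable U.

Lemma measurable_ball_metric (x : X) r : measurable (ball x r).
Proof.
apply: open_mu; rewrite openE => y; rewrite /interior ballEmdist/= => xy.
apply/nbhs_ballP; exists (r - mdist x y); first by rewrite /= subr_gt0.
move=> z; rewrite !ballEmdist/= ltrBrDl => yz.
exact: le_lt_trans (metric_triangle x y z) yz.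
Qed.

Lemma integral_bigcup_le (F : (set X)^nat) (f : X -> \bar R) :
  (forall n, measurable (F n)) -> measurable_fun setT f ->
  (forall x, 0 <= f x)%E ->
  (\int[mu]_(x in \bigcup_n F n) f x <= \sum_(0 <= n <oo) \int[mu]_(x in F n) f x)%E.
Proof.
move=> mF mf f0.
have mD n : measurable (seqDU F n).
  by apply: measurableD => //; apply: bigsetU_measurable => i _.
rewrite seqDU_bigcup_eq ge0_integral_bigcup//; last exact: measurable_funTS.
apply: lee_nneseries => [n _ _|n _]; first exact: integral_ge0.
apply: ge0_subset_integral => //; first exact: measurable_funTS.
by move=> x [].
Qed.

(** For each n only finitely many of the sets can have mass above 1 / (n + 1),
    because the total mass is finite. *)
Lemma disjoint_positive_countable (I : pointedType) (A : set I) (F : I -> set X)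
    (B : set X) (f : X -> \bar R) :
  measurable_fun setT f -> (forall x, 0 <= f x)%E ->
  measurable B -> (\int[mu]_(x in B) f x < +oo)%E ->
  (forall i, measurable (F i)) -> (forall i, A i -> F i `<=` B) ->
  trivIset A F -> (forall i, A i -> 0 < \int[mu]_(x in F i) f x)%E ->
  countable A.
Proof.
move=> mf f0 mB fB mF FB tF fF.
have fin i : A i -> (\int[mu]_(x in F i) f x)%E \is a fin_num.
  move=> Ai; rewrite ge0_fin_numE; last exact: integral_ge0.
  apply: le_lt_trans fB; apply: ge0_subset_integral => //; last exact: FB.
  exact: measurable_funTS.
pose v i := fine (\int[mu]_(x in F i) f x)%E.
rewrite [X in countable X](_ : _ =
    \bigcup_n (A `&` [set i | n.+1%:R^-1 < v i])); last first.
  apply/seteqP; split=> [i Ai|i [n _ [//]]].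
  have /ltr_add_invr[k] : 0 < v i by rewrite fine_gt0// fF//= ltey_eq fin.
  by rewrite add0r => h; exists k.
apply: bigcup_countable => // n _; apply: finite_set_countable.
apply: contrapT => /infiniteP/pcard_leP/injfunPex[/= q q_fun q_inj].
have Aq k : A (q k) by have [] := q_fun k Logic.I.
have vq k : n.+1%:R^-1 < v (q k) by have [] := q_fun k Logic.I.
have b0 : (0 <= \int[mu]_(x in B) f x)%E by exact: integral_ge0.
have bf : (\int[mu]_(x in B) f x)%E \is a fin_num by rewrite ge0_fin_numE.
set b := fine (\int[mu]_(x in B) f x)%E.
have tq : trivIset setT (F \o q).
  move=> i j _ _ ij.
  have qij := tF (q i) (q j) (Aq i) (Aq j) ij.
  exact: (q_inj i j (mem_set Logic.I) (mem_set Logic.I) qij).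
have sumb : (\sum_(0 <= k <oo) (v (q k))%:E <= b%:E)%E.
  have -> : (\sum_(0 <= k <oo) (v (q k))%:E =
      \int[mu]_(x in \bigcup_k F (q k)) f x)%E.
    rewrite ge0_integral_bigcup//; last exact: measurable_funTS.
    by apply: eq_eseriesr => k _; rewrite fineK// fin.
  rewrite fineK//; apply: ge0_subset_integral => //.
  - by apply: bigcup_measurable => k _.
  - exact: measurable_funTS.
  - by move=> x [k _]; apply: FB.
pose K := (Num.truncn (b * n.+1%:R)).+1.
suff h : b < \sum_(0 <= k < K) v (q k).
  have v0 k : (0 <= (v (q k))%:E)%E.
    by rewrite lee_fin (le_trans _ (ltW (vq k)))// invr_ge0.
  have := le_trans (@nneseries_lim_ge _ (fun k => (v (q k))%:E) xpredT 0 K (fun k _ _ => v0 k)) sumb.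
  by rewrite sumEFin lee_fin leNgt h.
apply: (@lt_le_trans _ _ (\sum_(0 <= k < K) n.+1%:R^-1)); last first.
  by apply: ler_sum => k _; exact/ltW/vq.
rewrite sumr_const_nat subn0 -[_ *+ K]mulr_natr mulrC ltr_pdivlMr//.
exact: truncnS_gt.
Qed.

(** The tripled balls of a Vitali subfamily cover [S], doubling compares their
    mass with that of the disjoint balls, and the integrals of [h] over those
    add up inside [N].  The subfamily is countable because the members centred
    in a fixed ball lie in a larger ball, of finite mass. *)
Lemma weak_type_covering (w h : X -> \bar R) (S N : set X) (r : X -> R)
    (rho c C : R) (x0 : X) :
  measurable_fun setT w -> (forall x, 0 <= w x)%E ->
  measurable_fun setT h -> (forall x, 0 <= h x)%E ->
  measurable S -> measurable N -> 0 <= c -> 0 <= C ->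
  (forall x s, 0 < s -> (\int[mu]_(y in ball x s) w y < +oo)%E) ->
  (forall x, S x -> 0 < r x <= rho) ->
  (forall x, S x -> ball x (r x) `<=` N) ->
  (forall x, S x -> 0 < \int[mu]_(y in ball x (r x)) w y)%E ->
  (forall x, S x -> \int[mu]_(y in ball x (3 * r x)%R) w y <=
     C%:E * \int[mu]_(y in ball x (r x)) w y)%E ->
  (forall x, S x -> c%:E * \int[mu]_(y in ball x (r x)) w y <=
     \int[mu]_(y in ball x (r x)) h y)%E ->
  (c%:E * \int[mu]_(y in S) w y <= C%:E * \int[mu]_(y in N) h y)%E.
Proof.
move=> mw w0 mh h0 mS mN c0 C0 wfin rS BN wpos wdbl wh.
have [A [AS tA cov]] := vitali_metric rS.
have mB (x : X) (s : R) : d.-measurable (ball x s) by exact: measurable_ball_metric.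
have cA : countable A.
  rewrite [X in countable X](_ : _ = \bigcup_n (A `&` ball x0 n%:R)); last first.
    apply/seteqP; split => [x Ax|x [n _ []//]].
    exists (Num.truncn (mdist x0 x)).+1 => //; split => //.
    by rewrite ballEmdist/=; exact: truncnS_gt.
  apply: bigcup_countable => // n _.
  apply: (@disjoint_positive_countable X _ (fun x => ball x (r x))
    (ball x0 (n%:R + `|rho| + 1)) w) => //.
  - by apply: wfin; rewrite ltr_wpDl// addr_ge0.
  - move=> x [Ax]; rewrite !ballEmdist/= => xn y /= xy.
    have /andP[_ xr] := rS x (AS x Ax).
    apply: le_lt_trans (metric_triangle x0 x y) _.
    have := ler_norm rho; lra.
  - by move=> i j [Ai _] [Aj _]; exact: tA.
  - by move=> x [/AS/wpos].
have /countable_bijP[D] := cA.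
rewrite card_eq_sym => /pcard_eqP/bijPex[/= q q_bij].
have DA k : D k -> A (q k) by case: q_bij => qf _ _ Dk; exact: qf.
pose F3 k := if k \in D then ball (q k) (3 * r (q k)) else set0.
pose F1 k := if k \in D then ball (q k) (r (q k)) else set0.
have mF3 k : measurable (F3 k) by rewrite /F3; case: ifP.
have mF1 k : measurable (F1 k) by rewrite /F1; case: ifP.
have w_ge0 (E : set X) : (0 <= \int[mu]_(y in E) w y)%E by exact: integral_ge0.
have h_ge0 (E : set X) : (0 <= \int[mu]_(y in E) h y)%E by exact: integral_ge0.
have SF : S `<=` \bigcup_n F3 n.
  move=> x /cov[y Ay yx].
  have [k Dk qk] : (q @` D) y by case: q_bij => _ _; apply.
  by exists k => //; rewrite /F3 mem_set// qk ballEmdist.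
have tF1 : trivIset setT F1.
  move=> i j _ _; rewrite /F1; case: ifPn => [/set_mem Di|_]; last by rewrite set0I => -[].
  case: ifPn => [/set_mem Dj|_]; last by rewrite setI0 => -[].
  move=> /(tA (q i) (q j) (DA i Di) (DA j Dj)) qij.
  by case: q_bij => _ qi _; apply: qi => //; exact: mem_set.
have step k : (c%:E * \int[mu]_(y in F3 k) w y <= C%:E * \int[mu]_(y in F1 k) h y)%E.
  rewrite /F3 /F1; case: ifPn => [/set_mem Dk|_]; last by rewrite !integral_set0 !mule0.
  have Sq := AS _ (DA k Dk).
  apply: (@le_trans _ _ (c%:E * (C%:E * \int[mu]_(y in ball (q k) (r (q k))) w y))%E).
    by apply: lee_wpmul2l; [rewrite lee_fin|exact: wdbl].
  rewrite muleCA; apply: lee_wpmul2l; first by rewrite lee_fin.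
  exact: wh.
have mU3 : measurable (\bigcup_n F3 n) by apply: bigcup_measurable => k _.
apply: (@le_trans _ _ (c%:E * \int[mu]_(y in \bigcup_n F3 n) w y)%E).
  apply: lee_wpmul2l; first by rewrite lee_fin.
  by apply: ge0_subset_integral => //; exact: measurable_funTS.
apply: (@le_trans _ _ (c%:E * \sum_(0 <= n <oo) \int[mu]_(y in F3 n) w y)%E).
  apply: lee_wpmul2l; first by rewrite lee_fin.
  exact: integral_bigcup_le.
rewrite -nneseriesZl; last by move=> k _; exact: w_ge0.
apply: (@le_trans _ _ (\sum_(0 <= n <oo) (C%:E * \int[mu]_(y in F1 n) h y))%E).
  apply: lee_nneseries => // k _ _; apply: mule_ge0; first by rewrite lee_fin.
  exact: w_ge0.
rewrite nneseriesZl; last by move=> k _; exact: h_ge0.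
apply: lee_wpmul2l; first by rewrite lee_fin.
rewrite -ge0_integral_bigcup//; last exact: measurable_funTS.
apply: ge0_subset_integral => //.
- by apply: bigcup_measurable => k _.
- exact: measurable_funTS.
- move=> x [k _]; rewrite /F1; case: ifPn => // /set_mem Dk.
  exact/BN/AS/DA.
Qed.

End covering.

(** The smallest index satisfying [P] starts a window of length [m] that
    contains all the others. *)
Lemma count_window (P : pred nat) (m n : nat) :
  (forall i j, P i -> P j -> (i <= j)%N -> (j < i + m)%N) ->
  (\sum_(0 <= k < n | P k) 1 <= m)%N.
Proof.
move=> Pm; rewrite sum1_count.
have [->//|] := posnP (count P (index_iota 0 n)).
rewrite -has_count -size_filter => /hasP[i0 _ Pi0].
have exP : exists i, P i by exists i0.
case: (ex_minnP exP) => i Pi mini.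
rewrite -[leqRHS](size_iota i); apply: uniq_leq_size.
  by rewrite filter_uniq// iota_uniq.
move=> k; rewrite mem_filter mem_iota => /andP[Pk _].
have ik := mini k Pk.
by rewrite ik (Pm i k).
Qed.

(** * The estimate on one distance shell *)

Section level_sets.
Context {R : realType} {d : measure_display} {X : metricMeasurableType d R}.
Variable mu : {measure set X -> \bar R}.
Hypothesis open_mu : forall U : set X, open U -> measurable U.

Lemma Borel_fun_measurable d' (T : measurableType d') (f : X -> T) :
  Borel_fun f -> measurable_fun setT f.
Proof.
move=> mf _ Y mY; have := mf measurableT Y mY.
move: (_ `&` _) => A; apply: smallest_sub => //.
exact: sigma_algebra_measurable.
Qed.

Variables (w : X -> \bar R) (Omega : set X) (p : R).
Hypothesis Omega_proper : Omega <> [set: X].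
Hypothesis p0 : 0 < p.
Hypothesis w_weight : is_weight mu w Omega.
Hypothesis w_dbl : semilocally_doubling mu w Omega.
Local Notation D x := (dist_set x (~` Omega)).
Local Notation W E := (wmeas mu w E).

Let w_meas : measurable_fun setT w.
Proof. by case: w_weight => mw _ _ _; exact: Borel_fun_measurable. Qed.

Let w_ge0 x : (0 <= w x)%E. Proof. by case: w_weight. Qed.

Lemma wmeas_ge0 E : (0 <= W E)%E. Proof. exact: integral_ge0. Qed.

Lemma wmeas_ball_lty x r : 0 < r -> (W (ball x r) < +oo)%E.
Proof. by case: w_weight => _ _ h _; exact: h. Qed.

Lemma dist_measurable : measurable_fun setT (fun x : X => D x).
Proof.
apply: Borel_fun_measurable; apply: lipschitz_Borel_fun.
exact: dist_set_lipschitz_fun.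
Qed.

Lemma measurable_shell (a b : R) : measurable [set x : X | a < D x <= b].
Proof.
have -> : [set x : X | a < D x <= b] = setT `&` (fun x : X => D x) @^-1` `]a, b].
  by rewrite setTI; apply/seteqP; split => x /=; rewrite in_itv.
exact: dist_measurable.
Qed.

Lemma measurable_neq0 (v : X -> R) : measurable_fun setT v ->
  measurable [set y | v y != 0].
Proof.
move=> mv; have -> : [set y | v y != 0] = setT `&` v @^-1` (~` [set 0]).
  by rewrite setTI; apply/seteqP; split => y /= /eqP.
by apply: (mv measurableT); apply: measurableC; exact: measurable_set1.
Qed.

Lemma measurable_dist_le b : measurable [set x : X | D x <= b].
Proof.
have -> : [set x : X | D x <= b] = [set x : X | -1 < D x <= b].
  apply/seteqP; split => x /=; last by case/andP.
  by move=> ->; rewrite (lt_le_trans _ (dist_set_ge0 Omega_proper x)).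
exact: measurable_shell.
Qed.

Lemma powR_measurable (f : X -> R) : measurable_fun setT f ->
  measurable_fun setT (fun y => ((f y `^ p)%:E * w y)%E).
Proof.
move=> mf; apply: emeasurable_funM => //; apply/measurable_EFinP.
exact: (measurableT_comp (measurable_powR p)).
Qed.

Lemma powR_mul_ge0 (f : X -> R) y : (0 <= (f y `^ p)%:E * w y)%E.
Proof. by rewrite mule_ge0// lee_fin powR_ge0. Qed.

Lemma doubling_triple_ball kappa : 0 < kappa -> exists2 C : R, 0 < C &
  forall x r, Omega x -> 0 < r -> r <= kappa * D x ->
    (0 < W (ball x r))%E /\ (W (ball x (3 * r)%R) <= C%:E * W (ball x r))%E.
Proof.
move=> k0; have [D0 D1 H] := w_dbl (mulr_gt0 (ltr0Sn R 3) k0).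
have D00 : 0 < D0 by exact: lt_le_trans D1.
exists (D0 * D0); first by rewrite mulr_gt0.
move=> x r Ox r0 rk; have kD : 0 < kappa * D x by exact: lt_le_trans rk.
have [h1 _ _] := H x r Ox r0 ltac:(rewrite -mulrA; lra).
split => //.
have [_ h2 _] := H x (4 * r) Ox ltac:(lra) ltac:(rewrite -mulrA; lra).
have [_ h3 _] := H x (2 * r) Ox ltac:(lra) ltac:(rewrite -mulrA; lra).
apply: (@le_trans _ _ (W (ball x (4 * r)%R))).
  apply: ge0_subset_integral => //; try exact: measurable_ball_metric.
    exact: measurable_funTS.
  by move=> y; rewrite !ballEmdist/=; lra.
apply: (le_trans h2); rewrite EFinM -muleA; apply: lee_wpmul2l.
  by rewrite lee_fin ltW.
have e1 : 4 * r / 2 = 2 * r :> R by field.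
have e2 : 2 * r / 2 = r :> R by field.
by rewrite e1 -[in leRHS]e2.
Qed.

(** Clears the exponent and the denominator from a lower bound on a weighted
    mean. *)
Lemma large_mean_le (f : X -> R) x r q : (forall y, 0 <= f y) -> 0 < r -> 0 <= q ->
  (0 < W (ball x r))%E -> (q%:E <= weighted_mean mu w p f x r)%E ->
  ((q `^ p)%:E * W (ball x r) <= \int[mu]_(y in ball x r) ((f y `^ p)%:E * w y))%E.
Proof.
move=> f0 r0 q0 Wpos.
have Wfin : W (ball x r) \is a fin_num by rewrite ge0_fin_numE ?wmeas_ge0 ?wmeas_ball_lty.
rewrite /weighted_mean.
under eq_integral do rewrite ger0_norm//.
set I := (\int[mu]_(y in _) _)%E.
have I0 : (0 <= I)%E by apply: integral_ge0 => y _; rewrite mule_ge0// lee_fin powR_ge0.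
move: Wpos; rewrite -(fineK Wfin); set W0 := fine _; rewrite lte_fin => Wpos.
have -> : (W0%:E^-1 = W0^-1%:E)%E by rewrite inver gt_eqF.
have m0 : (0 <= W0^-1%:E * I)%E by rewrite mule_ge0// lee_fin invr_ge0 ltW.
move=> h; have := @gt0_ler_poweR _ p (ltW p0) q%:E ((W0^-1%:E * I) `^ p^-1)%E.
rewrite !in_itv/= !leey !andbT lee_fin => /(_ q0 (poweR_ge0 _ _) h).
rewrite -poweRrM mulVf ?gt_eqF// poweRe1// => h2.
have := lee_wpmul2r (x := W0%:E) _ h2; rewrite lee_fin => /(_ (ltW Wpos)) /le_trans; apply.
by rewrite muleAC -EFinM mulVf ?gt_eqF// mul1e.
Qed.

Variables (CH kappa : R).
Hypotheses (CH0 : 0 < CH) (kappa1 : 1 < kappa).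
Hypothesis hardy : forall u g : X -> R, Lip0 Omega u -> upper_gradient u g ->
      bounded_function g -> forall x : X, Omega x ->
      (`|u x|%:E <= CH%:E * (D x)%:E * maximal mu w Omega p kappa g x)%E.

(** If all means at [x] were below s / (2 CH t), the pointwise inequality would
    give |u x| <= s / 2. *)
Lemma hardy_ball (u g : X -> R) x s t : Lip0 Omega u -> upper_gradient u g ->
  bounded_function g -> 0 < D x -> D x <= t -> 0 < s -> s <= `|u x| ->
  exists r, 0 < r < kappa * D x /\
    ((s / (2 * CH * t))%:E <= weighted_mean mu w p g x r)%E.
Proof.
move=> uL ug gb Dx0 Dxt s0 su.
have t0 : 0 < t by exact: lt_le_trans Dxt.
set q := s / (2 * CH * t).
have q0 : 0 < q by rewrite divr_gt0// !mulr_gt0.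
apply: contrapT => nr.
have Mq : (maximal mu w Omega p kappa g x <= q%:E)%E.
  apply: ge_ereal_sup => _ [->|[r /= rk <-]]; first by rewrite lee_fin ltW.
  by rewrite leNgt; apply/negP => /ltW h; apply: nr; exists r.
have Ox := dist_set_gt0_in Omega_proper Dx0.
have := hardy uL ug gb Ox; apply/negP; rewrite -ltNge.
apply: (@le_lt_trans _ _ (CH%:E * (D x)%:E * q%:E)%E).
  by apply: lee_wpmul2l => //; rewrite -EFinM lee_fin ltW// mulr_gt0.
rewrite -!EFinM lte_fin; apply: lt_le_trans su.
apply: (@le_lt_trans _ _ (CH * t * q)).
  by rewrite ler_wpM2r ?(ltW q0)// ler_wpM2l ?(ltW CH0).
rewrite (_ : CH * t * q = s / 2); last by rewrite /q; field; rewrite !gt_eqF.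
by rewrite ltr_pdivrMr// ltr_pMr// ltr1n.
Qed.

(** Where |v| >= 2 s the truncation of [v] equals [s], so [hardy_ball] provides
    balls with a large mean of the truncated gradient, to which
    [weak_type_covering] applies.  The balls have radius below kappa t, hence
    stay within D <= (1 + kappa) t. *)
Lemma level_estimate : exists2 K : R, 0 < K &
  forall v G : X -> R, Lip0 Omega v -> upper_gradient v G -> bounded_function G ->
  forall s t : R, 0 < s -> 0 < t ->
  ((s `^ p)%:E * W [set x | (t / 2 < D x <= t)%R /\ (2 * s <= `|v x|)%R]
   <= (K * t `^ p)%:E * \int[mu]_(y in [set y | (D y <= (1 + kappa) * t)%R])
        (((level_bump s (v y) * G y) `^ p)%:E * w y))%E.
Proof.
have k0 : 0 < kappa by exact: lt_trans kappa1.
have [C C0 dbl] := doubling_triple_ball k0.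
exists (C * (2 * CH) `^ p); first by rewrite mulr_gt0// powR_gt0// mulr_gt0.
move=> v G vL vG [M GM] s t s0 t0.
have [mG G0 _] := vG.
have {}GM x : G x <= M by exact: le_trans (ler_norm _) (GM x).
set S := [set x | _].
set h := fun y => level_bump s (v y) * G y.
have bump0 y := level_bump_ge0 s (v y).
have h0 y : 0 <= h y by rewrite mulr_ge0.
have uL := trunc_Lip0 s0 vL.
have ug := trunc_upper_gradient s0 vL.1 vG GM.
have hM : bounded_function h.
  exists M => y; rewrite ger0_norm//; apply: le_trans (GM y).
  by rewrite -[leRHS]mul1r ler_wpM2r// level_bump_le1.
set q := s / (2 * CH * t).
have q0 : 0 < q by rewrite divr_gt0// !mulr_gt0.
have ex_r x : exists r, S x -> 0 < r < kappa * D x /\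
    (q%:E <= weighted_mean mu w p h x r)%E.
  have [Sx|nS] := pselect (S x); last by exists 0.
  have [/andP[Dx xt] vx] := Sx.
  have Dx0 : 0 < D x by apply: lt_trans Dx; rewrite divr_gt0.
  have sx : s <= `|level_trunc s (v x)|.
    by rewrite level_trunc_hi ?(ltW s0)// gtr0_norm.
  have [r hr] := hardy_ball uL ug hM Dx0 xt s0 sx.
  by exists r.
have [r rP] := choice ex_r.
have SO x : S x -> Omega x.
  move=> [/andP[Dx _] _]; apply: (dist_set_gt0_in Omega_proper).
  by apply: lt_trans Dx; rewrite divr_gt0.
have mh : measurable_fun setT (fun y => ((h y `^ p)%:E * w y)%E).
  apply: emeasurable_funM => //; apply/measurable_EFinP.
  apply: (measurableT_comp (measurable_powR p)).
  apply: Borel_fun_measurable; case: ug => + _ _; exact.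
have mv : measurable_fun setT (fun y => `|v y|).
  apply: measurableT_comp => //; apply: Borel_fun_measurable.
  exact: lipschitz_Borel_fun vL.1.
have mS : measurable S.
  have -> : S = [set x | t / 2 < D x <= t] `&` (setT `&` (fun y => `|v y|) @^-1` `[2 * s, +oo[).
    by rewrite setTI; apply/seteqP; split => x /=; rewrite in_itv/= andbT.
  by apply: measurableI; [exact: measurable_shell|exact: mv].
have [x0 _] := setC_proper_neq0 Omega_proper.
have rS x : S x -> [/\ 0 < r x, r x <= kappa * D x & r x <= kappa * t].
  move=> Sx; have [/andP[r0 rk] _] := rP x Sx; split => //; first exact: ltW.
  apply: (le_trans (ltW rk)); rewrite ler_pM2l//.
  by case: Sx => /andP[].
have sE : s `^ p = (2 * CH) `^ p * t `^ p * q `^ p.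
  have a0 : 0 <= 2 * CH by rewrite mulr_ge0// ltW.
  have b0 : 0 <= 2 * CH * t by rewrite mulr_ge0// ltW.
  rewrite -(powRM _ a0 (ltW t0)) -(powRM _ b0 (ltW q0)).
  by congr (_ `^ _); rewrite /q; field; rewrite !gt_eqF.
rewrite sE EFinM -muleA.
rewrite [X in (_ <= X%:E * _)%E](_ : _ = (2 * CH) `^ p * t `^ p * C); last by ring.
rewrite [(_ * C)%:E]EFinM -[leRHS]muleA; apply: lee_wpmul2l.
  by rewrite lee_fin mulr_ge0// powR_ge0.
(* q is chosen so that q 2 CH t = s *)
apply: (@weak_type_covering _ _ _ mu open_mu w _ S _ r (kappa * t) _ _ x0) => //.
- by move=> y; rewrite mule_ge0// lee_fin powR_ge0.
- exact: measurable_dist_le.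
- exact: powR_ge0.
- exact: ltW.
- by move=> x s'; exact: wmeas_ball_lty.
- by move=> x /rS[-> _ ->].
- move=> x Sx y; rewrite ballEmdist/= => xy; rewrite /= mulrDl mul1r.
  have [_ _ rx] := rS x Sx; have [/andP[_ Dx] _] := Sx.
  have := dist_set_lipschitz Omega_proper x y.
  rewrite ler_norml => /andP[h1 _]; lra.
- by move=> x Sx; have [r0 rk _] := rS x Sx; have [] := dbl x (r x) (SO x Sx) r0 rk.
- by move=> x Sx; have [r0 rk _] := rS x Sx; have [] := dbl x (r x) (SO x Sx) r0 rk.
- move=> x Sx; have [r0 rk _] := rS x Sx; have [_ qm] := rP x Sx.
  apply: large_mean_le => //; first exact: ltW.
  by have [] := dbl x (r x) (SO x Sx) r0 rk.
Qed.


(** The bump at level s_k = T / 2^(k+1) lives on s_k < 2 |a| < 5 s_k; levels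
    whose ratio is at least 8 are incompatible, so at most three consecutive
    bumps are nonzero at [a]. *)
Lemma bump_sum_le (T a G : R) n : 0 < T -> 0 <= G ->
  \sum_(0 <= k < n) (level_bump (T / 2 ^+ k.+1) a * G) `^ p <= 3 * G `^ p.
Proof.
move=> T0 G0; pose P k := level_bump (T / 2 ^+ k.+1) a != 0.
have s0 k : 0 < T / 2 ^+ k.+1 by rewrite divr_gt0// exprn_gt0.
apply: (@le_trans _ _ (\sum_(0 <= k < n | P k) G `^ p)).
  rewrite [leRHS]big_mkcond/=; apply: ler_sum => k _; rewrite /P.
  case: eqVneq => [->|_]; first by rewrite mul0r powR0// gt_eqF.
  apply: ge0_ler_powR; rewrite ?nnegrE ?mulr_ge0 ?level_bump_ge0//; first exact: ltW.
  by rewrite -[leRHS]mul1r ler_wpM2r// level_bump_le1.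
have -> : \sum_(0 <= k < n | P k) G `^ p = (\sum_(0 <= k < n | P k) 1)%N%:R * G `^ p.
  by rewrite natr_sum mulr_suml; apply: eq_bigr => k _; rewrite mul1r.
rewrite ler_wpM2r ?powR_ge0// ler_nat; apply: count_window => i j Pi Pj ij.
have /andP[h1 _] := level_bump_supp (s0 i) Pi.
have /andP[_ h2] := level_bump_supp (s0 j) Pj.
rewrite ltnNge; apply/negP => ij3.
have sj : T / 2 ^+ j.+1 <= T / 2 ^+ i.+1 / 8.
  rewrite -mulrA -invfM ler_pM2l// lef_pV2 ?posrE ?mulr_gt0 ?exprn_gt0//.
  rewrite (_ : 8 = 2 ^+ 3) -?exprD; last by rewrite -natrX.
  by rewrite ler_eXn2l ?ltr1n// addSn ltnS.
have := s0 i; lra.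
Qed.

(** On the shell |v| <= L D <= L t, so the nonzero values of |v| are exhausted
    by the dyadic levels below T = (L + 1) t.  The level estimates are summed
    over these, and the right-hand sides add up by [bump_sum_le].  The factor
    v <> 0 is kept on the right: it is what confines the integral to the support
    of a cut-off. *)
Lemma shell_estimate : exists2 K : R, 0 < K &
  forall v G : X -> R, Lip0 Omega v -> upper_gradient v G -> bounded_function G ->
  forall t : R, 0 < t ->
  (\int[mu]_(x in [set x | (t / 2 < D x <= t)%R]) ((`|v x| `^ p)%:E * w x)
   <= (K * t `^ p)%:E *
      \int[mu]_(y in [set y | (D y <= (1 + kappa) * t)%R] `&` [set y | (v y != 0)%R])
        ((G y `^ p)%:E * w y))%E.
Proof.
have [K0 K00 lev] := level_estimate.
exists (3 * 4 `^ p * K0); first by rewrite !mulr_gt0// powR_gt0.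
move=> v G vL vG Gb t t0.
have [mG G0 _] := vG.
have [[L L0 vLip] v0] := vL.
set S := [set x | _]; set N := [set y | _]; set V := [set y | _].
(* L + 1 rather than L makes |v| < T strict and T positive *)
pose T := (L + 1) * t.
have T0 : 0 < T by rewrite mulr_gt0// ltr_wpDl.
pose s k := T / 2 ^+ k.+1.
have s0 k : 0 < s k by rewrite divr_gt0// exprn_gt0.
have s2 k : 2 * s k = T / 2 ^+ k by rewrite /s exprS; field; rewrite expf_neq0.
have mv : measurable_fun setT v.
  by apply: Borel_fun_measurable => //; exact: lipschitz_Borel_fun vL.1.
have mav : measurable_fun setT (fun y => `|v y|) by exact: measurableT_comp.
have mGd : measurable_fun setT G by exact: Borel_fun_measurable.
have mS : measurable S by exact: measurable_shell.
have mV : measurable V by exact: measurable_neq0.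
have mN : measurable N by exact: measurable_dist_le.
pose f x := ((`|v x| `^ p)%:E * w x)%E.
have mf : measurable_fun setT f by exact: powR_measurable.
have f0 x : (0 <= f x)%E by exact: (powR_mul_ge0 (fun x => `|v x|)).
pose E k := S `&` [set x | T / 2 ^+ k <= `|v x| < 2 * T / 2 ^+ k].
pose F k := [set x | (t / 2 < D x <= t)%R /\ (2 * s k <= `|v x|)%R].
have mE k : measurable (E k).
  apply: measurableI => //.
  have -> : [set x | T / 2 ^+ k <= `|v x| < 2 * T / 2 ^+ k] =
    setT `&` (fun y => `|v y|) @^-1` `[T / 2 ^+ k, 2 * T / 2 ^+ k[.
    by rewrite setTI; apply/seteqP; split => x /=; rewrite in_itv.
  by apply: (mav measurableT); exact: measurable_itv.
have mF k : measurable (F k).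
  have -> : F k = S `&` (setT `&` (fun y => `|v y|) @^-1` `[2 * s k, +oo[).
    by rewrite setTI; apply/seteqP; split => x /=; rewrite in_itv/= andbT.
  by apply: measurableI => //; apply: (mav measurableT); exact: measurable_itv.
have EF k : E k `<=` F k.
  move=> x [Sx /andP[h _]]; split => //.
  by rewrite s2.
have -> : (\int[mu]_(x in S) f x = \int[mu]_(x in S `&` V) f x)%E.
  rewrite [RHS]integral_mkcondr; apply: eq_integral => x _.
  rewrite patchE; case: ifPn => //; rewrite notin_setE /V/= => /negP.
  by rewrite negbK => /eqP vx; rewrite /f vx normr0 powR0 ?gt_eqF// mul0e.
have SVE : S `&` V `<=` \bigcup_k E k.
  move=> x [Sx /= vx].
  have a0 : 0 < `|v x| by rewrite normr_gt0.
  have aT : `|v x| < T.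
    apply: (le_lt_trans (Lip0_bound Omega_proper x vLip v0 L0)).
    case/andP: Sx => _ Dt; apply: (@le_lt_trans _ _ (L * t)); first by rewrite ler_wpM2l.
    by rewrite ltr_pM2r// ltrDl.
  have exk : exists k, T / 2 ^+ k <= `|v x|.
    pose k := (Num.truncn (T / `|v x|)).+1; exists k.
    rewrite ler_pdivrMr ?exprn_gt0// -ler_pdivrMl// mulrC.
    apply: (@le_trans _ _ k%:R); first by apply: ltW; exact: truncnS_gt.
    by rewrite -natrX ler_nat ltnW// ltn_expl.
  case: (ex_minnP exk) => -[|k] hk mink.
    by move: hk; rewrite expr0 divr1 leNgt aT.
  exists k.+1 => //; split => //=; rewrite hk/= ltNge.
  apply/negP => h; suff /mink : T / 2 ^+ k <= `|v x| by rewrite ltnn.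
  apply: le_trans h; rewrite exprS.
  by rewrite le_eqVlt; apply/orP; left; apply/eqP; field; rewrite expf_neq0.
have mUE : measurable (\bigcup_k E k) by apply: bigcup_measurable => k _.
apply: (@le_trans _ _ (\int[mu]_(x in \bigcup_k E k) f x)%E).
  apply: ge0_subset_integral => //; first exact: measurableI.
  exact: measurable_funTS.
apply: (le_trans (integral_bigcup_le _ mE mf f0)).
pose h k y := ((((level_bump (s k) (v y) * G y) `^ p)%:E * w y))%E.
have mh k : measurable_fun setT (h k).
  apply: powR_measurable; apply: Borel_fun_measurable => //.
  have [M GM] := Gb.
  by have [] := trunc_upper_gradient (s0 k) vL.1 vG (fun x => le_trans (ler_norm _) (GM x)).
have h0 k y : (0 <= h k y)%E.
  exact: (powR_mul_ge0 (fun y => level_bump (s k) (v y) * G y)).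
have step k : (\int[mu]_(x in E k) f x <=
    (4 `^ p * K0 * t `^ p)%:E * \int[mu]_(y in N) h k y)%E.
  apply: (@le_trans _ _ ((4 `^ p)%:E * ((s k `^ p)%:E * W (F k)))%E); last first.
    rewrite -mulrA EFinM -muleA; apply: lee_wpmul2l; first by rewrite lee_fin powR_ge0.
    exact: lev.
  rewrite muleA -EFinM -powRM ?(ltW (s0 k))//.
  apply: (@le_trans _ _ (\int[mu]_(x in E k) (((4 * s k) `^ p)%:E * w x))%E).
    apply: ge0_le_integral => //.
    - exact: measurable_funTS.
    - by apply: emeasurable_funM => //; exact: measurable_funTS.
    move=> x [_ /andP[_ h2]]; apply: lee_wpmul2r => //; rewrite lee_fin.
    have s4 : 0 <= 4 * s k by rewrite mulr_ge0// ltW.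
    apply: (ge0_ler_powR (ltW p0)); rewrite ?nnegrE//.
    apply: (le_trans (ltW h2)).
    by rewrite -mulrA -s2 mulrA -natrM.
  rewrite ge0_integralZl_EFin ?powR_ge0//; last exact: measurable_funTS.
  apply: lee_wpmul2l; first by rewrite lee_fin powR_ge0.
  by apply: ge0_subset_integral => //; exact: measurable_funTS.
apply: (@le_trans _ _ (\sum_(0 <= k <oo) ((4 `^ p * K0 * t `^ p)%:E * \int[mu]_(y in N) h k y))%E).
  by apply: lee_nneseries => [k _ _|k _]; [exact: integral_ge0|exact: step].
have A0 : 0 <= 4 `^ p * K0 * t `^ p by rewrite !mulr_ge0 ?powR_ge0// ltW.
rewrite nneseriesZl//; last by move=> k _; exact: integral_ge0.
rewrite -integral_nneseries//; last by move=> k; exact: measurable_funTS.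
rewrite (_ : 3 * 4 `^ p * K0 * t `^ p = 4 `^ p * K0 * t `^ p * 3); last by ring.
rewrite [X in (_ <= X * _)%E]EFinM -[leRHS]muleA; apply: lee_wpmul2l; first by rewrite lee_fin.
rewrite -ge0_integralZl_EFin//; last 3 first.
- exact: measurableI.
- by move=> y _; exact: powR_mul_ge0.
- by apply: measurable_funTS; exact: powR_measurable.
rewrite [leRHS]integral_mkcondr; apply: ge0_le_integral => //.
- by move=> y _; exact: nneseries_ge0.
- apply: (@ge0_emeasurable_sum _ _ _ N h predT) => // k _.
  exact: measurable_funTS.
- apply/measurable_restrict => //; apply: measurable_funTS.
  by apply: emeasurable_funM => //; exact: powR_measurable.
move=> y _; rewrite patchE; case: ifPn => [_|]; last first.
  rewrite notin_setE /V/= => /negP; rewrite negbK => /eqP vy.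
  rewrite eseries0// => k _ _; rewrite /h vy.
  have [->|/level_bump_supp-/(_ (s0 k))] := eqVneq (level_bump (s k) 0) 0.
    by rewrite mul0r powR0 ?gt_eqF// mul0e.
  by rewrite normr0 mulr0 ltNge (ltW (s0 k)).
apply: lime_le; first exact: is_cvg_nneseries.
apply: nearW => n.
rewrite -ge0_sume_distrl//; last by move=> k _; rewrite lee_fin powR_ge0.
rewrite muleA -EFinM sumEFin; apply: lee_wpmul2r => //; rewrite lee_fin.
exact: bump_sum_le.
Qed.

End level_sets.

(** * Summation over scales *)

Section real_lemmas.
Context {R : realType}.
Implicit Types (a b p K : R).

Lemma powR_div p a b : 0 <= a -> 0 < b -> (a / b) `^ p = a `^ p / b `^ p.
Proof.
move=> a0 b0; have bp : b `^ p != 0 by rewrite gt_eqF// powR_gt0.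
by apply: (mulIf bp); rewrite divfK// -powRM ?divfK ?gt_eqF ?divr_ge0// ltW.
Qed.

Lemma powRD_le p a b : 0 < p -> 0 <= a -> 0 <= b ->
  (a + b) `^ p <= 2 `^ p * (a `^ p + b `^ p).
Proof.
move=> p0; wlog ab : a b / a <= b.
  move=> H a0 b0; have /orP[ab|ba] := le_total a b; first exact: H.
  by rewrite addrC [X in _ * X]addrC; exact: H.
move=> a0 b0; apply: (@le_trans _ _ ((2 * b) `^ p)).
  apply: (ge0_ler_powR (ltW p0)); rewrite ?nnegrE ?addr_ge0 ?mulr_ge0//.
  by rewrite mulrDl mul1r lerD2r.
by rewrite powRM// ler_wpM2l ?powR_ge0// lerDr powR_ge0.
Qed.

(** The left-hand side is of order N^(1 - p). *)
Lemma log_cutoff_scales p K (m : nat) : 1 < p -> 0 < K -> exists N : nat,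
  [/\ (2 <= N)%N, (m <= N)%N &
      K * (m + N)%:R * (N%:R * ln 2)^-1 `^ p <= 2^-1].
Proof.
move=> p1 K0; have c0 := @ln2_gt0 R; set c := ln 2 in c0 *.
have p10 : 0 < p - 1 by rewrite subr_gt0.
pose y := (c / (4 * K)) `^ (p - 1)^-1.
have y0 : 0 < y by rewrite powR_gt0// divr_gt0// mulr_gt0.
(* N >= 1 / (c y) makes x = 1 / (N c) at most y, and y is chosen so that
   (2 K / c) y^(p - 1) = 1/2 *)
pose N := maxn 2 (maxn m (Num.truncn ((c * y)^-1)).+1).
have N2 : (2 <= N)%N by rewrite leq_maxl.
have mN : (m <= N)%N by rewrite /N !leq_max leqnn orbT.
exists N; split => //.
have N0 : 0 < N%:R :> R by rewrite ltr0n (leq_trans _ N2).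
have Ny : (c * y)^-1 <= N%:R.
  apply: (@le_trans _ _ (Num.truncn ((c * y)^-1)).+1%:R); first by apply: ltW; exact: truncnS_gt.
  by rewrite ler_nat /N !leq_max leqnn !orbT.
set x := (N%:R * c)^-1.
have x0 : 0 < x by rewrite invr_gt0 mulr_gt0.
have xy : x <= y.
  rewrite /x -[y]invrK lef_pV2 ?posrE ?invr_gt0 ?mulr_gt0//.
  by move: Ny; rewrite invfM mulrC ler_pdivrMr.
have xp : x `^ (p - 1) <= c / (4 * K).
  apply: (@le_trans _ _ (y `^ (p - 1))).
    by apply: (ge0_ler_powR (ltW p10)); rewrite ?nnegrE ?(ltW x0) ?(ltW y0).
  by rewrite /y -powRrM mulVf ?gt_eqF// powRr1 ?divr_ge0 ?mulr_ge0 ?(ltW c0) ?(ltW K0).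
rewrite -mulr_powRB1 ?(ltW x0)//; last exact: lt_trans p1.
apply: (@le_trans _ _ (K * (N%:R + N%:R) * (x * (c / (4 * K))))).
  apply: ler_pM; rewrite ?mulr_ge0 ?powR_ge0 ?(ltW x0) ?(ltW K0)//.
    by rewrite ler_pM2l// natrD lerD2r ler_nat.
  by rewrite ler_pM2l.
rewrite le_eqVlt; apply/orP; left; apply/eqP; rewrite /x.
by field; rewrite !gt_eqF.
Qed.

(** Sum the recursion over j < n.  For each of the M offsets [l], the terms of
    [a] on the right exceed those on the left by at most M terms, each at most
    [A]; since K M b <= 1/2, they can be absorbed. *)
Lemma absorb_window (a G : nat -> R) (m M : nat) (K b E A : R) :
  (forall i, 0 <= a i) -> (forall i, 0 <= G i) -> 0 <= K -> 0 <= b -> (m <= M)%N ->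
  (forall j, a (m + j)%N <= K * \sum_(0 <= l < M) (G (j + l)%N + b * a (j + l)%N)) ->
  (forall n, \sum_(0 <= i < n) G i <= E) -> (forall i, a i <= A) ->
  K * M%:R * b <= 2^-1 ->
  forall n, \sum_(0 <= j < n) a (m + j)%N <= 2 * K * M%:R * E + M%:R * A.
Proof.
move=> a0 G0 K0 b0 mM rec GE aA KMb n.
set S := \sum_(0 <= j < n) _.
have shift (f : nat -> R) l : (forall i, 0 <= f i) ->
    \sum_(0 <= j < n) f (j + l)%N <= \sum_(0 <= i < n + l) f i.
  move=> f0; have -> : \sum_(0 <= j < n) f (j + l)%N = \sum_(l <= i < n + l) f i.
    by rewrite -{2}[l]add0n big_addn addnK.
  by rewrite [leRHS](@big_cat_nat _ _ _ l) ?leq_addl//= lerDr sumr_ge0.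
have SG l : \sum_(0 <= j < n) G (j + l)%N <= E by exact: le_trans (shift G l G0) (GE _).
have Sa l : (l < M)%N -> \sum_(0 <= j < n) a (j + l)%N <= S + M%:R * A.
  move=> lM; apply: (le_trans (shift a l a0)).
  apply: (@le_trans _ _ (\sum_(0 <= i < n + M) a i)).
    rewrite [leRHS](@big_cat_nat _ _ _ (n + l)) ?leq_add2l ?(ltnW lM)//= lerDl.
    by apply: sumr_ge0.
  rewrite (@big_cat_nat _ _ _ m) ?(leq_trans mM) ?leq_addl//=.
  rewrite [X in _ + X](@big_cat_nat _ _ _ (n + m)) ?leq_addl ?leq_add2l//=.
  have -> : \sum_(m <= i < n + m) a i = S.
    rewrite -{1}[m]add0n big_addn addnK; apply: eq_bigr => i _; by rewrite addnC.
  have h1 : \sum_(0 <= i < m) a i <= m%:R * A.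
    apply: (@le_trans _ _ (\sum_(0 <= i < m) A)); first exact: ler_sum.
    by rewrite sumr_const_nat subn0 -[leLHS]mulr_natl.
  have h2 : \sum_(n + m <= i < n + M) a i <= (M - m)%:R * A.
    apply: (@le_trans _ _ (\sum_(n + m <= i < n + M) A)); first exact: ler_sum.
    by rewrite sumr_const_nat subnDl mulr_natl.
  move: h2; rewrite natrB// mulrBl; lra.
have main : S <= K * M%:R * E + K * M%:R * b * (S + M%:R * A).
  apply: (@le_trans _ _ (\sum_(0 <= j < n) K * \sum_(0 <= l < M) (G (j + l)%N + b * a (j + l)%N))).
    exact: ler_sum.
  rewrite -mulr_sumr exchange_big_nat/=.
  rewrite (_ : K * M%:R * E + K * M%:R * b * (S + M%:R * A) =
    K * (M%:R * (E + b * (S + M%:R * A)))); last by ring.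
  rewrite ler_wpM2l//.
  apply: (@le_trans _ _ (\sum_(0 <= l < M) (E + b * (S + M%:R * A)))).
    rewrite !big_nat; apply: ler_sum => l /andP[_ lM].
    rewrite big_split/= -mulr_sumr lerD// ler_wpM2l//; exact: Sa.
  by rewrite sumr_const_nat subn0 -[leLHS]mulr_natl.
have SA0 : 0 <= S + M%:R * A.
  by rewrite addr_ge0 ?sumr_ge0 ?mulr_ge0// (le_trans (a0 0%N)).
have := ler_wpM2r SA0 KMb.
have -> : 2 * K * M%:R * E = 2 * (K * M%:R * E) by ring.
by move: main; lra.
Qed.

End real_lemmas.

(** * The Hardy inequality *)

Section hardy.
Context {R : realType} {d : measure_display} {X : metricMeasurableType d R}.
Variable mu : {measure set X -> \bar R}.
Hypothesis open_mu : forall U : set X, open U -> measurable U.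
Variables (w : X -> \bar R) (Omega : set X) (p : R).
Hypothesis Omega_proper : Omega <> [set: X].
Hypothesis Omega_open : open Omega.
Hypothesis p1 : 1 < p.
Hypothesis w_weight : is_weight mu w Omega.
Hypothesis w_dbl : semilocally_doubling mu w Omega.
Hypothesis w_hardy : pointwise_hardy mu w Omega p.
Local Notation D x := (dist_set x (~` Omega)).
Let p0 : 0 < p. Proof. exact: lt_trans p1. Qed.
Let w_meas : measurable_fun setT w.
Proof. by case: w_weight => mw _ _ _; exact: Borel_fun_measurable. Qed.
Let w_ge0 x : (0 <= w x)%E. Proof. by case: w_weight. Qed.

Definition hardy_quotient (u : X -> R) x : R := `|u x| `^ p / D x `^ p.
Local Notation q := hardy_quotient.

Let shell (a b : R) : set X := [set x | (a < D x <= b)%R].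

Let mshell a b : measurable (shell a b). Proof. exact: measurable_shell. Qed.

Lemma hardy_quotient_ge0 u x : 0 <= q u x.
Proof. by rewrite divr_ge0// powR_ge0. Qed.

Lemma hardy_quotient_measurable u : Lip0 Omega u -> measurable_fun setT (q u).
Proof.
move=> uL.
apply: measurable_funM.
  apply: (measurableT_comp (measurable_powR p)); apply: measurableT_comp => //.
  by apply: Borel_fun_measurable => //; exact: lipschitz_Borel_fun uL.1.
rewrite (_ : (fun x => _) = (fun x => D x `^ (- p))); last first.
  by apply/funext => x; rewrite powRN.
apply: (measurableT_comp (measurable_powR (- p))).
exact: dist_measurable.
Qed.

(** The first bound is the shell estimate for [u], the second the one for [u]
    times the logarithmic cut-off, which is at least 1/2 on the shell.  The
    support of the cut-off removes the part D <= t 2^-N from the right-hand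
    side; 2^m is a power of two above 1 + kappa. *)
Lemma hardy_shell : exists K : R, exists m : nat, 0 < K /\
  forall u g : X -> R, Lip0 Omega u -> upper_gradient u g -> bounded_function g ->
  forall t : R, 0 < t ->
  (\int[mu]_(x in shell (t / 2)%R t) ((q u x)%:E * w x)
   <= K%:E * \int[mu]_(x in Omega) ((g x `^ p)%:E * w x))%E /\
  forall N, (2 <= N)%N ->
  (\int[mu]_(x in shell (t / 2)%R t) ((q u x)%:E * w x) <= K%:E *
   \int[mu]_(x in shell (t / 2 ^+ N)%R (2 ^+ m * t)%R)
     ((g x `^ p + (N%:R * ln 2)^-1 `^ p * q u x)%:E * w x))%E.
Proof.
have [CH [kappa [CH0 kappa1 hardy]]] := w_hardy.
have [K0 K00 est] := shell_estimate open_mu Omega_proper p0 w_weight w_dbl CH0 kappa1 hardy.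
pose m := (Num.truncn (1 + kappa)).+1.
have km : 1 + kappa <= 2 ^+ m.
  apply: (@le_trans _ _ m%:R); first by apply: ltW; exact: truncnS_gt.
  by rewrite -natrX ler_nat ltnW// ltn_expl.
exists (8 `^ p * K0), m; split; first by rewrite mulr_gt0// powR_gt0.
move=> u g uL ug gb t t0.
have mq : measurable_fun setT (fun x => ((q u x)%:E * w x)%E).
  apply: emeasurable_funM => //; apply/measurable_EFinP.
  exact: hardy_quotient_measurable.
have q0 x : (0 <= (q u x)%:E * w x)%E by rewrite mule_ge0// lee_fin hardy_quotient_ge0.
have mg : measurable_fun setT g by case: ug => mg _ _; exact: Borel_fun_measurable.
have g0 x : 0 <= g x by case: ug.
have mO : measurable Omega by exact: open_mu.
have quotient_le v c : 0 <= c -> Lip0 Omega v -> (forall x, t / 2 < D x -> `|u x| <= c * `|v x|) ->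
    (\int[mu]_(x in shell (t / 2)%R t) ((q u x)%:E * w x) <=
    ((2 * c / t) `^ p)%:E * \int[mu]_(x in shell (t / 2)%R t) ((`|v x| `^ p)%:E * w x))%E.
  move=> c0 vL uv.
  have mv : measurable_fun setT (fun x => ((`|v x| `^ p)%:E * w x)%E).
    apply: (powR_measurable open_mu p w_weight); apply: measurableT_comp => //.
    by apply: Borel_fun_measurable => //; exact: lipschitz_Borel_fun vL.1.
  rewrite -ge0_integralZl_EFin//; last 3 first.
  - by move=> x _; exact: (powR_mul_ge0 p w_weight (fun x => `|v x|)).
  - exact: measurable_funTS.
  - exact: powR_ge0.
  apply: ge0_le_integral => //.
  - exact: measurable_funTS.
  - by apply: emeasurable_funM => //; exact: measurable_funTS.
  move=> x /andP[Dx _].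
  have D0 : 0 < D x by apply: lt_trans Dx; rewrite divr_gt0.
  rewrite muleA -EFinM; apply: lee_wpmul2r => //; rewrite lee_fin.
  have ct0 : 0 <= 2 * c / t by rewrite divr_ge0 ?mulr_ge0// ltW.
  rewrite -powRM// /q -powR_div//.
  apply: (ge0_ler_powR (ltW p0)); rewrite ?nnegrE.
  - by rewrite divr_ge0// ltW.
  - exact: mulr_ge0.
  rewrite ler_pdivrMr//; apply: (le_trans (uv x Dx)).
  have h : 1 <= 2 / t * D x by rewrite mulrAC ler_pdivlMr// mul1r; lra.
  apply: (@le_trans _ _ (c * `|v x| * (2 / t * D x))).
    by rewrite ler_peMr// mulr_ge0.
  by rewrite le_eqVlt; apply/orP; left; apply/eqP; field; rewrite gt_eqF.
split.
  have u1 x : t / 2 < D x -> `|u x| <= 1 * `|u x| by rewrite mul1r.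
  apply: (le_trans (quotient_le u 1 ler01 uL u1)).
  apply: (@le_trans _ _ (((2 * 1 / t) `^ p)%:E * ((K0 * t `^ p)%:E *
      \int[mu]_(x in Omega) ((g x `^ p)%:E * w x)))%E).
    apply: lee_wpmul2l; first by rewrite lee_fin powR_ge0.
    apply: (le_trans (est u g uL ug gb t t0)).
    apply: lee_wpmul2l; first by rewrite lee_fin mulr_ge0 ?powR_ge0// ltW.
    apply: ge0_subset_integral => //.
    - apply: measurableI; first exact: measurable_dist_le.
      apply: measurable_neq0; apply: Borel_fun_measurable => //.
      exact: lipschitz_Borel_fun uL.1.
    - by apply: measurable_funTS; exact: (powR_measurable open_mu p w_weight).
    - by move=> x _; exact: (powR_mul_ge0 p w_weight).
    - move=> x [_ /= ux]; apply: contrapT => /uL.2 ux0.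
      by move: ux; rewrite ux0 eqxx.
  rewrite muleA -EFinM; apply: lee_wpmul2r.
    by apply: integral_ge0 => x _; exact: (powR_mul_ge0 p w_weight).
  rewrite lee_fin mulr1 powR_div//.
  rewrite (_ : 2 `^ p / t `^ p * (K0 * t `^ p) = 2 `^ p * K0); last first.
    by field; rewrite gt_eqF// powR_gt0.
  rewrite ler_wpM2r ?(ltW K00)//; apply: (ge0_ler_powR (ltW p0)); rewrite ?nnegrE//.
  by rewrite ler_nat.
move=> N N2.
have N0 : (0 < N)%N by exact: leq_trans N2.
have [[L L0 uLip] u0] := uL; have [M gM] := gb.
have {}gM x : g x <= M by exact: le_trans (ler_norm _) (gM x).
set v := cutoff_fun Omega N t u.
set G := cutoff_gradient Omega N t u g.
have vL : Lip0 Omega v by exact: cutoff_Lip0 N0 t0 L0 uLip u0.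
have vG : upper_gradient v G by exact: cutoff_upper_gradient N0 t0 L0 uLip u0 ug gM.
have G0 x : 0 <= G x by case: vG.
have Gb : bounded_function G.
  exists (M + L * (N%:R * ln 2)^-1) => x; rewrite ger0_norm//.
  exact: (cutoff_gradient_le _ N0 t0 L0 uLip u0 ug gM).
have uv x : t / 2 < D x -> `|u x| <= 2 * `|v x|.
  move=> Dx; rewrite /v /cutoff_fun normrM [`|log_cutoff _ _ _|]ger0_norm ?log_cutoff_ge0//.
  have := log_cutoff_ge_half N0 t0 N2 (ltW Dx) => h.
  by rewrite mulrCA ler_peMr// -ler_pdivrMl// mulr1.
apply: (le_trans (quotient_le v 2 (ler0n _ _) vL uv)).
apply: (@le_trans _ _ (((2 * 2 / t) `^ p)%:E * ((K0 * t `^ p)%:E *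
   ((2 `^ p)%:E * \int[mu]_(x in shell (t / 2 ^+ N)%R (2 ^+ m * t)%R)
     ((g x `^ p + (N%:R * ln 2)^-1 `^ p * q u x)%:E * w x))))%E).
  apply: lee_wpmul2l; first by rewrite lee_fin powR_ge0.
  apply: (le_trans (est v G vL vG Gb t t0)).
  apply: lee_wpmul2l; first by rewrite lee_fin mulr_ge0 ?powR_ge0// ltW.
  set S := shell (t / 2 ^+ N) (2 ^+ m * t).
  have mS : measurable S by exact: mshell.
  have mG : measurable_fun setT (fun x => ((G x `^ p)%:E * w x)%E).
    apply: (powR_measurable open_mu p w_weight); apply: Borel_fun_measurable => //.
    by case: vG.
  apply: (@le_trans _ _ (\int[mu]_(x in S) ((G x `^ p)%:E * w x))%E).
    apply: ge0_subset_integral => //.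
    - apply: measurableI; first exact: measurable_dist_le.
      apply: measurable_neq0; apply: Borel_fun_measurable => //.
      exact: lipschitz_Borel_fun vL.1.
    - exact: measurable_funTS.
    - by move=> x _; exact: (powR_mul_ge0 p w_weight).
    move=> x [/= Dx vx]; rewrite /S /shell/= (le_trans Dx) ?ler_pM2r// andbT.
    rewrite ltNge; apply/negP => Dd; move: vx.
    by rewrite /v /cutoff_fun log_cutoff_eq0// mulr0 eqxx.
  set bp := (N%:R * ln 2)^-1 `^ p.
  have bp0 : 0 <= bp by exact: powR_ge0.
  have H0 x : (0 <= (g x `^ p + bp * q u x)%:E * w x)%E.
    apply: mule_ge0 => //; rewrite lee_fin; apply: addr_ge0; first exact: powR_ge0.
    by apply: mulr_ge0 => //; exact: hardy_quotient_ge0.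
  have mH : measurable_fun setT (fun x => ((g x `^ p + bp * q u x)%:E * w x)%E).
    apply: emeasurable_funM => //; apply/measurable_EFinP.
    apply: measurable_funD.
      exact: (measurableT_comp (measurable_powR p)).
    by apply: measurable_funM => //; exact: hardy_quotient_measurable.
  rewrite -ge0_integralZl_EFin//; last exact: measurable_funTS.
  apply: ge0_le_integral => //.
  - by move=> x _; exact: (powR_mul_ge0 p w_weight).
  - exact: measurable_funTS.
  - by apply: emeasurable_funM => //; exact: measurable_funTS.
  move=> x /andP[Dx _].
  have D0 : 0 < D x by apply: lt_trans Dx; rewrite divr_gt0// exprn_gt0.
  rewrite muleA -EFinM; apply: lee_wpmul2r => //; rewrite lee_fin.
  have b0 : 0 < (N%:R * ln 2)^-1 :> R by rewrite invr_gt0 mulr_gt0 ?ltr0n// ln2_gt0.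
  have bpE : bp * q u x = (`|u x| * ((N%:R * ln 2)^-1 / D x)) `^ p.
    have bD : 0 <= (N%:R * ln 2)^-1 / D x by rewrite divr_ge0// ltW.
    by rewrite powRM// powR_div ?(ltW b0)// /hardy_quotient mulrCA.
  rewrite bpE; apply: le_trans (powRD_le p0 (g0 x) _); last first.
    by rewrite mulr_ge0// divr_ge0// ltW.
  apply: (ge0_ler_powR (ltW p0)); rewrite ?nnegrE//.
    by rewrite addr_ge0// mulr_ge0// divr_ge0// ltW.
  rewrite /G /cutoff_gradient (max_l (ltW Dx)) lerD2r.
  by rewrite -[leRHS]mul1r ler_wpM2r// log_cutoff_le1.
rewrite !muleA -!EFinM; apply: lee_wpmul2r.
  apply: integral_ge0 => x _; apply: mule_ge0 => //; rewrite lee_fin.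
  apply: addr_ge0; first exact: powR_ge0.
  by apply: mulr_ge0; [exact: powR_ge0|exact: hardy_quotient_ge0].
rewrite lee_fin powR_div ?mulr_ge0//.
rewrite (_ : 8 = 2 * 2 * 2); last by ring.
rewrite [(2 * 2 * 2) `^ p]powRM ?mulr_ge0//.
rewrite le_eqVlt; apply/orP; left; apply/eqP; field.
by rewrite gt_eqF// powR_gt0.
Qed.

Lemma integral_shells (f : X -> \bar R) t n : measurable_fun setT f ->
  (forall x, 0 <= f x)%E -> 0 < t ->
  (\int[mu]_(x in shell (t / 2 ^+ n)%R t) f x =
   \sum_(0 <= i < n) \int[mu]_(x in shell (t / 2 ^+ i / 2)%R (t / 2 ^+ i)%R) f x)%E.
Proof.
move=> mf f0 t0; elim: n => [|n IH].
  rewrite big_geq// (_ : shell _ _ = set0) ?integral_set0//.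
  rewrite expr0 divr1; apply/seteqP; split => x //= /andP[h1 h2].
  by move: h1; rewrite ltNge h2.
rewrite big_nat_recr//= -IH.
have h : 0 < t / 2 ^+ n by rewrite divr_gt0// exprn_gt0.
have e1 : t / 2 ^+ n.+1 = t / 2 ^+ n / 2 by rewrite exprS invfM mulrA mulrAC.
have le1 : t / 2 ^+ n <= t.
  by rewrite ler_pdivrMr ?exprn_gt0// ler_peMr ?exprn_ege1 ?ler1n// ltW.
rewrite e1 -ge0_integral_setU//=.
- congr (integral _ _ _); apply/seteqP; split => x /=.
    move=> /andP[h1 h2]; have [h3|h3] := leP (D x) (t / 2 ^+ n).
      by right; apply/andP.
    by left; apply/andP.
  move=> [/andP[h1 h2]|/andP[h1 h2]]; apply/andP; split => //.
    by apply: lt_trans h1; lra.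
  exact: le_trans le1.
- exact: measurable_funTS.
- apply/disj_setPS => x [/andP[h1 _] /andP[_ h2]].
  by move: h1; rewrite ltNge h2.
Qed.

(** For scales tau 2^-j with j < n, [absorb_window] applies to the shell
    integrals with base 2^m tau: the shift by [m] accounts for the larger scales
    that [hardy_shell] reaches.  The bound does not depend on [tau] and [n], and
    the sets 2^-n < D <= 2^n exhaust Omega. *)
Lemma hardy_inequality : exists2 C : R, 0 < C &
  forall u g : X -> R, Lip0 Omega u -> upper_gradient u g -> bounded_function g ->
  (\int[mu]_(x in Omega) ((q u x)%:E * w x)
   <= C%:E * \int[mu]_(x in Omega) ((g x `^ p)%:E * w x))%E.
Proof.
have [K [m [K0 est]]] := hardy_shell.
have [N [N2 mN KN]] := log_cutoff_scales m p1 K0.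
set b := _ `^ p in KN; have b0 : 0 <= b by exact: powR_ge0.
pose M := (m + N)%N.
have M0 : 0 < M%:R :> R by rewrite ltr0n addn_gt0 (leq_trans _ N2) ?orbT.
pose C := 2 * K * M%:R + M%:R * K.
exists C; first by rewrite addr_gt0 ?mulr_gt0.
move=> u g uL ug gb.
have mO : measurable Omega by exact: open_mu.
have mq : measurable_fun setT (fun x => ((q u x)%:E * w x)%E).
  apply: emeasurable_funM => //; apply/measurable_EFinP.
  exact: hardy_quotient_measurable.
have q0 x : (0 <= (q u x)%:E * w x)%E by rewrite mule_ge0// lee_fin hardy_quotient_ge0.
have mg : measurable_fun setT (fun x => ((g x `^ p)%:E * w x)%E).
  apply: (powR_measurable open_mu p w_weight).
  by case: ug => mg _ _; exact: Borel_fun_measurable.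
have g0 x : (0 <= (g x `^ p)%:E * w x)%E by exact: (powR_mul_ge0 p w_weight).
set E := (\int[mu]_(x in Omega) ((g x `^ p)%:E * w x))%E.
have E0 : (0 <= E)%E by apply: integral_ge0 => x _; exact: g0.
have [Ey|Efin] := eqVneq E +oo%E.
  by rewrite Ey gt0_muley ?leey// lte_fin addr_gt0 ?mulr_gt0.
have {}Efin : E \is a fin_num by rewrite ge0_fin_numE// lt_neqAle Efin leey.
pose e := fine E; have eE : e%:E = E by rewrite fineK.
have claim tau n : 0 < tau ->
    (\int[mu]_(x in shell (tau / 2 ^+ n)%R tau) ((q u x)%:E * w x) <= (C * e)%:E)%E.
  move=> tau0; (* shell m + j of this sequence is the shell at scale tau / 2^j *)
  pose r i := 2 ^+ m * tau / 2 ^+ i.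
  have r0 i : 0 < r i by rewrite divr_gt0 ?mulr_gt0 ?exprn_gt0.
  pose a' i := (\int[mu]_(x in shell (r i / 2)%R (r i)) ((q u x)%:E * w x))%E.
  pose G' i := (\int[mu]_(x in shell (r i / 2)%R (r i)) ((g x `^ p)%:E * w x))%E.
  have a'0 i : (0 <= a' i)%E by exact: integral_ge0.
  have G'0 i : (0 <= G' i)%E by exact: integral_ge0.
  have a'E i : (a' i <= K%:E * E)%E by have [] := est u g uL ug gb (r i) (r0 i).
  have shellO s t : 0 <= s -> shell s t `<=` Omega.
    move=> s0 x /andP[h _]; apply: (dist_set_gt0_in Omega_proper).
    exact: le_lt_trans h.
  have G'E n' : (\sum_(0 <= i < n') G' i <= E)%E.
    rewrite -integral_shells ?mulr_gt0 ?exprn_gt0//.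
    apply: ge0_subset_integral => //; first exact: measurable_funTS.
    by apply: shellO; rewrite divr_ge0// ltW// mulr_gt0// exprn_gt0.
  have a'fin i : a' i \is a fin_num.
    by rewrite ge0_fin_numE// (le_lt_trans (a'E i))// -eE -EFinM ltry.
  have G'fin i : G' i \is a fin_num.
    rewrite ge0_fin_numE//; apply: (@le_lt_trans _ _ E); last by rewrite -eE ltry.
    apply: le_trans (G'E i.+1); rewrite big_nat_recr//= leeDr//.
    exact: sume_ge0.
  pose a i := fine (a' i); pose G i := fine (G' i).
  have rec j : a (m + j)%N <= K * \sum_(0 <= l < M) (G (j + l)%N + b * a (j + l)%N).
    have [_ /(_ N N2)] := est u g uL ug gb (r (m + j)%N) (r0 _).
    rewrite -/b -/(a' _).
    have -> : 2 ^+ m * r (m + j)%N = r j.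
      by rewrite /r exprD; field; rewrite !expf_neq0.
    have -> : r (m + j)%N / 2 ^+ N = r j / 2 ^+ M.
      by rewrite /r /M !exprD; field; rewrite !expf_neq0.
    rewrite integral_shells//; last 2 first.
    - apply: emeasurable_funM => //; apply/measurable_EFinP.
      apply: measurable_funD.
        apply: (measurableT_comp (measurable_powR p)).
        by case: ug => mg' _ _; exact: Borel_fun_measurable.
      by apply: measurable_funM => //; exact: hardy_quotient_measurable.
    - move=> x; apply: mule_ge0 => //; rewrite lee_fin; apply: addr_ge0; first exact: powR_ge0.
      by apply: mulr_ge0 => //; exact: hardy_quotient_ge0.
    rewrite (_ : (\sum_(0 <= i < M) _)%E =
        (\sum_(0 <= l < M) (G (j + l)%N + b * a (j + l)%N))%:E).
      by rewrite -(fineK (a'fin (m + j)%N)) -EFinM lee_fin.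
    rewrite -sumEFin; apply: eq_bigr => l _.
    have -> : r j / 2 ^+ l = r (j + l)%N by rewrite /r exprD invfM mulrA.
    rewrite EFinD EFinM !fineK//.
    have split_sum x : ((g x `^ p + b * q u x)%:E * w x =
        (g x `^ p)%:E * w x + b%:E * ((q u x)%:E * w x))%E.
      rewrite EFinD ge0_muleDl ?lee_fin ?powR_ge0// ?EFinM ?muleA//.
      by apply: mulr_ge0 => //; exact: hardy_quotient_ge0.
    under eq_integral do rewrite split_sum.
    rewrite ge0_integralD//; last 3 first.
    - exact: measurable_funTS.
    - by move=> x _; rewrite mule_ge0.
    - by apply: emeasurable_funM => //; exact: measurable_funTS.
    by rewrite ge0_integralZl_EFin//; exact: measurable_funTS.
  have := @absorb_window _ a G m M K b e (K * e) _ _ (ltW K0) b0 (leq_addr _ _) rec _ _ KN n.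
  have -> : 2 * K * M%:R * e + M%:R * (K * e) = C * e by rewrite /C; ring.
  move=> fin; rewrite integral_shells//.
  apply: (@le_trans _ _ (\sum_(0 <= j < n) a (m + j)%N)%:E).
    rewrite -sumEFin le_eqVlt; apply/orP; left; apply/eqP.
    apply: eq_bigr => j _; rewrite fineK// /a'.
    have -> // : r (m + j)%N = tau / 2 ^+ j.
    by rewrite /r exprD; field; rewrite !expf_neq0.
  rewrite lee_fin; apply: fin.
  - by move=> i; exact: fine_ge0.
  - by move=> i; exact: fine_ge0.
  - move=> n'; rewrite -lee_fin -sumEFin eE; apply: le_trans (G'E n').
    by under eq_bigr do rewrite fineK//.
  - by move=> i; rewrite -lee_fin fineK// EFinM eE.
(* the claim with 2^n as top scale and 2 n shells below it *)
pose F n := shell (2 ^+ n / 2 ^+ (n + n))%R (2 ^+ n)%R.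
have FE n : F n = [set x | ((2 ^+ n)^-1 < D x <= 2 ^+ n)%R].
  rewrite /F /shell; apply/seteqP; split => x /=;
  by rewrite exprD invfM mulrA divff ?mul1r// expf_neq0.
have mF n : measurable (F n) by exact: mshell.
have ndF : {homo F : n n' / (n <= n')%N >-> (n <= n')%O}.
  move=> n n' nn'; apply/subsetPset; rewrite !FE => x /= /andP[h1 h2].
  have h3 : 2 ^+ n <= 2 ^+ n' :> R by rewrite ler_eXn2l ?ltr1n.
  rewrite (le_trans h2)// andbT; apply: le_lt_trans h1.
  by rewrite lef_pV2 ?posrE ?exprn_gt0.
have UF : \bigcup_n F n = Omega.
  apply/seteqP; split => x.
    move=> [n _]; rewrite FE => /andP[h _]; apply: (dist_set_gt0_in Omega_proper).
    by apply: lt_trans h; rewrite invr_gt0 exprn_gt0.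
  move=> Ox; have D0 := dist_set_gt0 Omega_proper Omega_open Ox.
  pose n := (Num.truncn (D x + (D x)^-1)).+1.
  have hn : D x + (D x)^-1 < 2 ^+ n.
    apply: (@lt_le_trans _ _ n%:R); first exact: truncnS_gt.
    by rewrite -natrX ler_nat ltnW// ltn_expl.
  exists n => //; rewrite FE /=; apply/andP; split.
    rewrite -[ltRHS]invrK ltf_pV2 ?posrE ?exprn_gt0 ?invr_gt0//.
    by apply: le_lt_trans hn; rewrite lerDr ltW.
  by apply: ltW; apply: le_lt_trans hn; rewrite lerDl invr_ge0 ltW.
have cvgF := @ge0_nondecreasing_set_cvg_integral _ _ _ F
  (fun x => ((q u x)%:E * w x)%E) mu ndF mF (fun n => measurable_funTS mq) (fun n x _ => q0 x).
rewrite UF in cvgF.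
rewrite -(cvg_lim _ cvgF)//; apply: lime_le; first by apply/cvg_ex; eexists; exact: cvgF.
apply: nearW => n; rewrite -eE -EFinM.
exact: claim.
Qed.

End hardy.

Theorem theorem8p2 (R : realType) (d : measure_display)
  (X : metricMeasurableType d R) (mu : {measure set X -> \bar R}) (CQC : R)
  (X_two_points : exists x y : X, x <> y)
  (mu_complete : measure_is_complete mu)
  (mu_borel_regular : borel_regular mu)
  (mu_doubling : doubling mu)
  (CQC_ge1 : 1 <= CQC)
  (X_quasiconvex : quasiconvex X CQC)
  (p0 p : R) (p0_ge1 : 1 <= p0) (p0_lt_p : p0 < p)
  (Omega : set X) (Omega_open : open Omega) (Omega_neq0 : Omega !=set0)
  (Omega_proper : Omega <> [set: X])
  (w : X -> \bar R)
  (w_doubling : semilocally_doubling mu w Omega)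
  (w_poincare : poincare_weight mu CQC w Omega p0)
  (w_hardy : pointwise_hardy mu w Omega p) :
  exists2 C : R, 0 < C &
    forall u g : X -> R, Lip0 Omega u -> upper_gradient u g ->
      bounded_function g ->
    (\int[mu]_(x in Omega)
        ((`|u x| `^ p / dist_set x (~` Omega) `^ p)%R%:E * w x)
     <= C%:E * \int[mu]_(x in Omega) ((g x `^ p)%R%:E * w x))%E.
Proof.
have p1 : 1 < p by exact: le_lt_trans p0_lt_p.
have [open_mu _] := mu_borel_regular.
exact: (hardy_inequality open_mu Omega_proper Omega_open p1 w_poincare.1 w_doubling w_hardy).
Qed.
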